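(* Let $A$ be any single-mode subsystem of a light real scalar field theory ($m/H\ll1$), compactly supported in a super-Hubble region ($RH\gg1$) of the cosmological patch of de Sitter spacetime with Hubble rate $H$, and defined from smearing functions not belonging to the special (zero-average) family. When the field is in the Bunch--Davies vacuum, the von Neumann entropy $S(\nu_A)$ of $A$ grows monotonically with $H$. That is, for fixed smearing functions and fixed sufficiently small $\mu^2>0$, there is $H_0>0$ such that $H\mapsto S(\nu_A)$ is increasing on $[H_0,\infty)$.
   Context: Units $\hbar=c=1$. Fourier transform $\tilde h(\vec k)=\int d^3x\,h(\vec x)e^{i\vec k\cdot\vec x}$; Sobolev product of order $s$: $(f,g)_s=\int\frac{d^3k}{(2\pi)^3}|\vec k|^{2s}\tilde f(\vec k)\tilde g^*(\vec k)$. Setting. The cosmological patch of de Sitter space has metric $ds^2=a^2(\eta)(-d\eta^2+d\vec x^2)$, $a=-1/(H\eta)$, $\eta<0$. For a Klein--Gordon field of mass $m$ put $\mu^2=\frac32-\sqrt{\frac94-\frac{m^2}{H^2}}$. The Bunch--Davies vacuum is the zero-mean pure Gaussian state annihilated by the operators multiplying the modes $\sqrt{-\pi\eta/(4a^2)}\,H^{(1)}_{3/2-\mu^2}(-k\eta)e^{i\vec k\cdot\vec x}$. The operators $\hat\Phi=\hat\phi$ and $\hat\Pi=a^2\partial_\eta\hat\phi$ are taken at the time when $a=1$. Phase space and observables. Elements $\gamma=(g,f)$ are pairs of real functions with $g\in\dot H_{1/2}(\mathbb R^3)$, $f\in\dot H_{-1/2}(\mathbb R^3)$ (homogeneous Sobolev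 spaces) and symplectic form $\omega(\gamma_1,\gamma_2)=\int d^3x(f_1g_2-g_1f_2)$; to $\gamma$ corresponds the operator $\hat O_\gamma=\hat\Phi(f)-\hat\Pi(g)$, where $\hat\Phi(f)=\int d^3x f\hat\Phi$, etc. The covariance metric of the state is $\sigma(\gamma,\gamma')=\langle\{\hat O_\gamma,\hat O_{\gamma'}\}\rangle$. Regime. In the regime $\mu^2\ll1$, terms of order $\mathcal O(\mu^2)$ are neglected, and the covariance metric of the Bunch--Davies vacuum is given by its leading-order form $$\sigma(\gamma,\gamma')=\mathrm{Re}(g,g')_{\frac12}+\mathrm{Re}(f,f')_{-\frac12}+\kappa^2H^{2-2\mu^2}\mathrm{Re}(f,f')_{-\frac32+\mu^2}-\kappa H^{1-\mu^2}\left[\mathrm{Re}(f,g')_{-\frac{1-\mu^2}2}+\mathrm{Re}(f',g)_{-\frac{1-\mu^2}2}\right],$$ $$\kappa=\frac{2^{1-\mu^2}\sqrt\pi}{\cos(\pi\mu^2)\,\Gamma(-\frac12+\mu^2)}.$$ $R$ denotes the characteristic radius of the support of the mode; it is fixed when $H$ varies. Single-mode subsystem. $A$ is given by a two-dimensional symplectic subspace $\Gamma_A=\mathrm{span}[\gamma_A^{(1)},\gamma_A^{(2)}]$ with $\gamma_A^{(i)}=(g_A^{(i)},f_A^{(i)})$ compactly supported and $\omega(\gamma_A^{(2)},\gamma_A^{(1)})=1$. Its covariance matrix is $\sigma_A=(\sigma(\gamma_A^{(i)},\gamma_A^{(j)}))_{i,j=1,2}$, $\nu_A=\sqrt{\det\sigma_A}$,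 and its von Neumann entropy is $$S(\nu_A)=\tfrac{\nu_A+1}2\log_2\tfrac{\nu_A+1}2-\tfrac{\nu_A-1}2\log_2\tfrac{\nu_A-1}2.$$ Special family: functions $f$ with $\int_{\mathbb R^3}d^3x\,f(\vec x)=0$. ''Not belonging to the special family'' means that every non-zero $f_A^{(i)}$ has non-zero integral (one of the $f_A^{(i)}$ may vanish identically). *)

(* Defs.v *)
From HB Require Import structures.
From mathcomp Require Export all_boot all_order all_algebra.
From mathcomp Require Export all_classical all_reals all_analysis.
From mathcomp Require Export complex.
From mathcomp Require Import ring lra.

Set Implicit Arguments.
Unset Strict Implicit.
Unset Printing Implicit Defensive.

Export Order.TTheory GRing.Theory Num.Theory.
Export numFieldNormedType.Exports.

Global Open Scope classical_set_scope.
Global Open Scope ring_scope.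

(* Notations rather than constants, so that the topological and measurable
   structures and the sigma-finiteness of the measure are inferred. *)
Notation space R := ((R * R) * R)%type.
Notation lebesgue3 R :=
  ((@lebesgue_measure R \x @lebesgue_measure R) \x @lebesgue_measure R)%E.

Section Definitions.
Context {R : realType}.
Local Open Scope complex_scope.

Local Notation space := (space R).
Local Notation lebesgue3 := (lebesgue3 R).

Definition integral3 (F : space -> R) : R := \int[lebesgue3]_x F x.

Definition cintegral3 (F : space -> R[i]) : R[i] :=
  integral3 (fun x => complex.Re (F x)) +i* integral3 (fun x => complex.Im (F x)).

Definition dot3 (k x : space) : R :=
  k.1.1 * x.1.1 + k.1.2 * x.1.2 + k.2 * x.2.

(* The library norm on a product type is the sup norm. *)
Definition enorm3 (k : space) : R := Num.sqrt (dot3 k k).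

Definition expi (t : R) : R[i] := cos t +i* sin t.

Definition fourier (h : space -> R) (k : space) : R[i] :=
  cintegral3 (fun x => (h x)%:C * expi (dot3 k x)).

Definition sobolev_density (s : R) (f g : space -> R) (k : space) : R[i] :=
  ((2 * pi) ^- 3 * enorm3 k `^ (2 * s))%:C * (fourier f k * (fourier g k)^*).

Definition sobolev (s : R) (f g : space -> R) : R[i] :=
  cintegral3 (sobolev_density s f g).

(* For functions of compact support only: such a function is a distribution
   precisely when it is (locally) integrable, its Fourier transform is then the
   continuous function [fourier h], and membership in the homogeneous Sobolev
   space of order [s] amounts to finiteness of the norm. *)
Definition in_sobolev (s : R) (h : space -> R) : Prop :=
  lebesgue3.-integrable setT (EFin \o h) /\
  lebesgue3.-integrable setT
    (fun k => (complex.Re (sobolev_density s h h k))%:E).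

Definition compactly_supported (h : space -> R) : Prop :=
  compact (closure [set x | h x != 0]).

Record phase : Type := Phase { gpart : space -> R; fpart : space -> R }.

Definition symplectic (c1 c2 : phase) : R :=
  integral3 (fun x => fpart c1 x * gpart c2 x - gpart c1 x * fpart c2 x).

(* A single mode is given by a basis [gam 0], [gam 1] of its symplectic plane;
   the last condition forces the two vectors to be linearly independent. *)
Definition single_mode (gam : 'I_2 -> phase) : Prop :=
  [/\ forall i, in_sobolev 2^-1 (gpart (gam i)) /\
                in_sobolev (- 2^-1) (fpart (gam i)),
      forall i, compactly_supported (gpart (gam i)) /\
                compactly_supported (fpart (gam i))
    & symplectic (gam 1) (gam 0) = 1].

Definition zero_average (f : space -> R) : Prop := integral3 f = 0.

(* Phase-space elements are functions up to null sets, so "non-zero" is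
   "not almost everywhere zero". *)
Definition non_special (gam : 'I_2 -> phase) : Prop :=
  forall i, ~ {ae lebesgue3, forall x, fpart (gam i) x = 0} ->
            ~ zero_average (fpart (gam i)).

Definition Gamma_pos (z : R) : R :=
  \int[@lebesgue_measure R]_(t in `]0, +oo[) (t `^ (z - 1) * expR (- t)).

(* The Gamma function on the real line: Euler's integral for z > 0, and its
   continuation by Gamma (z + n) = z (z + 1) ... (z + n - 1) Gamma z below. *)
Definition Gamma (z : R) : R :=
  if 0 < z then Gamma_pos z
  else let n := (absz (Num.floor z)).+1 in
       Gamma_pos (z + n%:R) / \prod_(j < n) (z + j%:R).

Definition musq (m H : R) : R :=
  3 / 2 - Num.sqrt (9 / 4 - m ^+ 2 / H ^+ 2).

(* Holding [musq] fixed while [H] varies means scaling the mass like [H]; every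
   value in [0, 3/2] is attained this way. *)
Lemma musq_mass (mu2 H : R) : mu2 <= 3 / 2 -> 0 < H ->
  0 <= mu2 -> musq (H * Num.sqrt (mu2 * (3 - mu2))) H = mu2.
Proof.
move=> mu2le H0 mu20; have p : 0 <= 3 / 2 - mu2 by rewrite subr_ge0.
have q : 0 <= mu2 * (3 - mu2).
  by rewrite mulr_ge0// subr_ge0 (le_trans mu2le)// ler_pdivrMr// ler_peMr// ler1n.
have -> : musq (H * Num.sqrt (mu2 * (3 - mu2))) H =
          3 / 2 - Num.sqrt ((3 / 2 - mu2) ^+ 2).
  rewrite /musq exprMn sqr_sqrtr//; congr (_ - Num.sqrt _).
  by field; rewrite gt_eqF.
by rewrite sqrtr_sqr ger0_norm// subKr.
Qed.

Definition kappa (mu2 : R) : R :=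
  2 `^ (1 - mu2) * Num.sqrt pi /
  (cos (pi * mu2) * Gamma (- 2^-1 + mu2)).

(* Covariance metric of the Bunch-Davies vacuum of a field of mass [m] at
   Hubble rate [H], to leading order for [musq m H] << 1. *)
Definition bd_sigma (m H : R) (c c' : phase) : R :=
  let mu2 := musq m H in
  let (g, f) := c in
  let (g', f') := c' in
  complex.Re (sobolev 2^-1 g g') + complex.Re (sobolev (- 2^-1) f f')
  + kappa mu2 ^+ 2 * H `^ (2 - 2 * mu2) * complex.Re (sobolev (- (3 / 2) + mu2) f f')
  - kappa mu2 * H `^ (1 - mu2) *
    (complex.Re (sobolev (- ((1 - mu2) / 2)) f g') +
     complex.Re (sobolev (- ((1 - mu2) / 2)) f' g)).

Definition covariance_matrix (m H : R) (gam : 'I_2 -> phase) : 'M[R]_2 :=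
  \matrix_(i, j) bd_sigma m H (gam i) (gam j).

Definition nu (m H : R) (gam : 'I_2 -> phase) : R :=
  Num.sqrt (\det (covariance_matrix m H gam)).

Definition log2 (x : R) : R := ln x / ln 2.

Definition entropy (n : R) : R :=
  (n + 1) / 2 * log2 ((n + 1) / 2) - (n - 1) / 2 * log2 ((n - 1) / 2).

End Definitions.

Arguments phase R : clear implicits.

(* Main.v *)
(* In Fourier space the covariance matrix at y = kappa H^(1 - mu^2) is the Gram
   matrix of the vectors (|k|^(1/2) g^ - y |k|^(-3/2 + mu^2) f^, |k|^(-1/2) f^), so its
   determinant is a quartic in y, whose top coefficient is the Gram determinant
   of the weighted transforms of the two field parts.
   If this vanishes, one may subtract a multiple of one mode from the other to
   cancel its field part; then the determinant is a quadratic in y, whose top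
   coefficient is again a Gram determinant, of |k|^(1/2) g'^ and
   |k|^(-3/2 + mu^2) f^. These two are not proportional: at k -> 0 proportionality
   would force the integral of f to vanish, or g' = 0, and the latter, by
   injectivity of the Fourier transform, makes the symplectic product zero.
   Either way the determinant eventually increases to infinity with H, and the
   entropy is increasing in the symplectic eigenvalue above 1. *)
From HB Require Import structures.
Require Import Defs.
From mathcomp Require Import measurable_realfun ring lra.

Set Implicit Arguments.
Unset Strict Implicit.
Unset Printing Implicit Defensive.

Local Notation integrable3 h :=
  ((lebesgue3 _).-integrable [set: space _] (EFin \o h)).

(** * Sigma-finite products and measurability of partial integrals *)

Section SigmaFiniteProduct.
Context d1 d2 (T1 : measurableType d1) (T2 : measurableType d2) (R : realType).
Variables (m1 : {sigma_finite_measure set T1 -> \bar R})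
  (m2 : {sigma_finite_measure set T2 -> \bar R}).

(* An alias, because on [product_measure1] itself the instance for
   subprobabilities hides the sigma-finite one. *)
Definition sigma_finite_product : set (T1 * T2) -> \bar R := (m1 \x m2)%E.

(** Two increasing exhaustions can be paired at one index: the larger of two indices serves both
    factors. *)
Let sigma_finite_product_finite : sigma_finite setT sigma_finite_product.
Proof.
have /sigma_finiteP[F [TF ndF Foo]] := sigma_finiteT m1.
have /sigma_finiteP[G [TG ndG Goo]] := sigma_finiteT m2.
exists (fun n => F n `*` G n) => [|n].
  apply/seteqP; split => // -[x y] _.
  have [n _ Fx] : (\bigcup_k F k) x by rewrite -TF.
  have [m _ Gy] : (\bigcup_k G k) y by rewrite -TG.
  exists (maxn n m) => //; split => /=.
    by move: x Fx; apply/subsetPset/ndF/leq_maxl.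
  by move: y Gy; apply/subsetPset/ndG/leq_maxr.
have [mF Fn] := Foo n; have [mG Gn] := Goo n.
split; first exact: measurableX.
by rewrite /sigma_finite_product product_measure1E// lte_mul_pinfty// ge0_fin_numE.
Qed.

HB.instance Definition _ := Measure.on sigma_finite_product.
HB.instance Definition _ := Measure_isSigmaFinite.Build _ _ _
  sigma_finite_product sigma_finite_product_finite.

End SigmaFiniteProduct.

(** The measurability part of Tonelli's theorem; the alias, convertible with [lebesgue3], supplies
    the sigma-finite structure of the inner measure. *)
Lemma measurable_integral3 (R : realType) d (T : measurableType d) (f : T * space R -> \bar R) :
  measurable_fun setT f -> (forall z, 0 <= f z)%E ->
  measurable_fun setT (fun t => \int[lebesgue3 R]_x f (t, x))%E.
Proof.
move=> mf f0; pose L := @lebesgue_measure R.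
exact: (measurable_fun_fubini_tonelli_F
  (m2 := sigma_finite_product (sigma_finite_product L L) L) f mf f0).
Qed.

(** * Bernoulli estimates and polynomial approximation of a step *)

Section Powers.
Context {R : realType}.

(** Induction from [(1 - a) (1 + (n + 1) a) <= 1 + n a], the difference being [(n + 1) a ^ 2]. *)
Lemma bernoulli_inv (a : R) (n : nat) : 0 <= a <= 1 ->
  (1 - a) ^+ n * (1 + n%:R * a) <= 1.
Proof.
move=> /andP[a0 a1]; elim: n => [|n ih]; first by rewrite expr0 mul0r addr0 mul1r.
apply: le_trans ih; rewrite exprSr -mulrA ler_wpM2l ?exprn_ge0 ?subr_ge0//.
rewrite -natr1; have := ler0n R n; nra.
Qed.

Lemma bernoulli_sub (a : R) (n : nat) : 0 <= a <= 1 ->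
  1 - n%:R * a <= (1 - a) ^+ n.
Proof.
move=> /andP[a0 a1]; elim: n => [|n ih]; first by rewrite expr0 mul0r subr0.
rewrite exprSr -natr1.
have := ler_wpM2r (_ : 0 <= 1 - a) ih; rewrite subr_ge0 => /(_ a1).
by apply: le_trans; have := ler0n R n; nra.
Qed.

(** With [s = sqrt r], [bernoulli_inv] at [1 - s] bounds [n s ^ n] by [1 / (1 - s)], which leaves a
    spare factor [s ^ n] tending to 0. *)
Lemma cvg_natrM_expr (r : R) : 0 <= r < 1 -> n%:R * r ^+ n @[n --> \oo] --> 0.
Proof.
move=> /andP[r0 r1]; pose s := Num.sqrt r.
have s0 : 0 <= s by exact: sqrtr_ge0.
have s1 : s < 1 by rewrite -sqrtr1 ltr_sqrt.
have d0 : 0 < 1 - s by rewrite subr_gt0.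
have rs : r = s * s by rewrite -expr2 sqr_sqrtr.
apply: (@squeeze_cvgr _ _ _ _ (cst 0) (fun n => s ^+ n / (1 - s))).
- apply: nearW => n; rewrite mulr_ge0 ?exprn_ge0//= rs exprMn mulrA.
  rewrite [leRHS]mulrC ler_wpM2r ?exprn_ge0//.
  rewrite -[leRHS]mul1r ler_pdivlMr//.
  have s01 : 0 <= 1 - s <= 1 by rewrite ltW//= lerBlDr lerDl.
  have := bernoulli_inv n s01; rewrite subKr.
  by have := exprn_ge0 n s0; move: d0; nra.
- exact: cvg_cst.
- rewrite -[X in _ --> X](mul0r (1 - s)^-1); apply: cvgM; last exact: cvg_cst.
  by apply: cvg_expr; rewrite ger0_norm.
Qed.

(** Below [1 / 2], Bernoulli gives the lower bound [1 - n (2 u) ^ n], which tends to 1. From [1 / 2]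
    on, [(2 u) ^ n >= 1] and [bernoulli_inv] gives the upper bound [1 / (n + 1)]. *)
Lemma cvg_step (u : R) : 0 <= u <= 1 ->
  (1 - u ^+ n) ^+ (n * 2 ^ n) @[n --> \oo] --> ((u < 2^-1)%R%:R : R).
Proof.
move=> /andP[u0 u1].
have un n : 0 <= u ^+ n <= 1 by rewrite exprn_ge0//= exprn_ile1.
have [uh|uh] := ltP u 2^-1.
  apply: (@squeeze_cvgr _ _ _ _ (fun n => 1 - n%:R * (2 * u) ^+ n) (cst 1)).
  - apply: nearW => n; rewrite exprn_ile1 ?andbT; last 2 first.
    + by have /andP[? ?] := un n; rewrite subr_ge0.
    + by have /andP[? ?] := un n; rewrite lerBlDr lerDl.
    by rewrite (le_trans _ (bernoulli_sub _ (un n)))// natrM natrX exprMn mulrA.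
  - rewrite -[X in _ --> X]subr0; apply: cvgB; first exact: cvg_cst.
    by apply: cvg_natrM_expr; lra.
  - exact: cvg_cst.
apply: (@squeeze_cvgr _ _ _ _ (cst 0) (fun n => n.+1%:R^-1)).
- apply: nearW => n /=; rewrite exprn_ge0 /=; last first.
    by have /andP[? ?] := un n; rewrite subr_ge0.
  rewrite -[leRHS]mul1r ler_pdivlMr ?ltr0n//.
  apply: le_trans (bernoulli_inv (n * 2 ^ n) (un n)).
  rewrite ler_wpM2l ?exprn_ge0//.
    by have /andP[? ?] := un n; rewrite subr_ge0.
  rewrite -natr1 addrC lerD2l natrM -mulrA ler_peMr//.
  by rewrite natrX -exprMn exprn_ege1//; lra.
- exact: cvg_cst.
- exact: cvg_harmonic.
Qed.

End Powers.

(** * Phase transforms and the kernel of the Fourier transform *)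

Section PhaseTransform.
Context {R : realType}.
Implicit Types (h u : space R -> R) (k x : space R).

Lemma dot3D k l x : dot3 (k + l) x = dot3 k x + dot3 l x.
Proof. by rewrite /dot3 /=; ring. Qed.

Lemma dot3B k l x : dot3 (k - l) x = dot3 k x - dot3 l x.
Proof. by rewrite /dot3 /=; ring. Qed.

Lemma dot3Zl (a : R) k x : dot3 (a *: k) x = a * dot3 k x.
Proof. by rewrite /dot3 /= /GRing.scale /=; ring. Qed.

Lemma measurable_coord1 : measurable_fun [set: space R] (fun x => x.1.1).
Proof. exact: measurableT_comp measurable_fst measurable_fst. Qed.

Lemma measurable_coord2 : measurable_fun [set: space R] (fun x => x.1.2).
Proof. exact: measurableT_comp measurable_snd measurable_fst. Qed.

Lemma measurable_coord3 : measurable_fun [set: space R] (fun x => x.2).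
Proof. exact: measurable_snd. Qed.

Lemma measurable_dot3 k : measurable_fun setT (dot3 k).
Proof.
apply: measurable_funD; first apply: measurable_funD.
- exact: measurable_funM (measurable_cst _) measurable_coord1.
- exact: measurable_funM (measurable_cst _) measurable_coord2.
- exact: measurable_funM (measurable_cst _) measurable_coord3.
Qed.

Lemma measurable_cos_dot3 k (p : R) :
  measurable_fun setT (fun x => cos (dot3 k x + p)).
Proof.
apply: measurableT_comp; first exact: continuous_measurable_fun (@continuous_cos R).
by apply: measurable_funD => //; exact: measurable_dot3.
Qed.

Lemma normr_cos_le1 (t : R) : `|cos t| <= 1.
Proof. by rewrite ler_norml cos_geN1 cos_le1. Qed.

Lemma integrable3M h u : integrable3 h -> measurable_fun setT u ->
  (forall x, `|u x| <= 1) -> integrable3 (fun x => h x * u x).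
Proof.
move=> hi mu u1; apply: (le_integrable measurableT _ _ hi).
  apply/measurable_EFinP; apply: measurable_funM => //.
  by apply/measurable_EFinP; exact: measurable_int hi.
by move=> x _ /=; rewrite lee_fin normrM ler_piMr.
Qed.

Lemma integrable3D h h' : integrable3 h -> integrable3 h' ->
  integrable3 (fun x => h x + h' x).
Proof. by move=> hi hi'; have := integrableD measurableT hi hi'. Qed.

Lemma integrable3B h h' : integrable3 h -> integrable3 h' ->
  integrable3 (fun x => h x - h' x).
Proof. by move=> hi hi'; have := integrableB measurableT hi hi'. Qed.

Lemma integrable3Z (a : R) h : integrable3 h -> integrable3 (fun x => a * h x).
Proof. by move=> hi; have := integrableZl measurableT a hi. Qed.

(* Real and imaginary parts of the Fourier transform are the phases [0] and [- (pi / 2)]. *)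
Definition phase_transform h k (p : R) : R :=
  integral3 (fun x => h x * cos (dot3 k x + p)).

Lemma integrable3_cos h k p : integrable3 h ->
  integrable3 (fun x => h x * cos (dot3 k x + p)).
Proof.
move=> hi; apply: integrable3M => //; first exact: measurable_cos_dot3.
by move=> x; exact: normr_cos_le1.
Qed.

Lemma phase_transformB h h' k p : integrable3 h -> integrable3 h' ->
  phase_transform (fun x => h x - h' x) k p =
  phase_transform h k p - phase_transform h' k p.
Proof.
move=> hi hi'; rewrite /phase_transform /integral3.
rewrite -RintegralB//; [|exact: integrable3_cos..].
by apply: eq_Rintegral => x _; rewrite mulrBl.
Qed.

Lemma phase_transformZ a h k p : integrable3 h ->
  phase_transform (fun x => a * h x) k p = a * phase_transform h k p.
Proof.
move=> hi; rewrite /phase_transform /integral3 -RintegralZl//; last exact: integrable3_cos.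
by apply: eq_Rintegral => x _; rewrite mulrA.
Qed.

Lemma integral3_cvg (h_ : nat -> space R -> R) h g :
  (forall n, measurable_fun setT (h_ n)) -> integrable3 g ->
  (forall n x, `|h_ n x| <= g x) -> (forall x, h_ n x @[n --> \oo] --> h x) ->
  integrable3 h /\ integral3 (h_ n) @[n --> \oo] --> integral3 h.
Proof.
move=> mh gi hg hh.
have cv x : (EFin \o h_ ^~ x) @ \oo --> (h x)%:E.
  by apply/fine_cvgP; split; [exact: nearW|exact: hh].
have mh' : measurable_fun setT h by apply: measurable_fun_cvg => // x _; exact: hh.
have [] := @dominated_convergence _ _ _ (lebesgue3 R) _ measurableT
  (fun n => EFin \o h_ n) (EFin \o h) (EFin \o g).
- by move=> n; apply/measurable_EFinP; exact: mh.
- exact/measurable_EFinP.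
- by apply/aeW => x _; exact: cv.
- exact: gi.
- by apply/aeW => x n _; rewrite /= lee_fin.
move=> hi _ c; split => //.
by rewrite /integral3 /Rintegral; apply: fine_cvg; rewrite fineK//; exact: integrable_fin_num.
Qed.

(** The kernel of the Fourier transform. All phases are included so that multiplication by shifted
    cosines stays inside the class. *)
Definition annihilated h := integrable3 h /\ forall k p, phase_transform h k p = 0.

Lemma annihilatedB h h' : annihilated h -> annihilated h' ->
  annihilated (fun x => h x - h' x).
Proof.
move=> [hi h0] [hi' h0']; split; first exact: integrable3B.
by move=> k p; rewrite phase_transformB// h0 h0' subr0.
Qed.

Lemma annihilatedZ a h : annihilated h -> annihilated (fun x => a * h x).
Proof.
move=> [hi h0]; split; first exact: integrable3Z.
by move=> k p; rewrite phase_transformZ// h0 mulr0.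
Qed.

(** The product formula for cosines turns the new transform into a mean of transforms of [h] at the
    frequencies [l + k] and [l - k]. *)
Lemma annihilated_cos h l q : annihilated h ->
  annihilated (fun x => h x * cos (dot3 l x + q)).
Proof.
move=> [hi h0]; split; first exact: integrable3_cos.
move=> k p; have := RintegralD (mu := lebesgue3 R) measurableT
  (integrable3Z 2^-1 (integrable3_cos (l + k) (q + p) hi))
  (integrable3Z 2^-1 (integrable3_cos (l - k) (q - p) hi)).
rewrite !RintegralZl; [|exact: measurableT|exact: integrable3_cos|
  exact: measurableT|exact: integrable3_cos].
have := h0 (l + k) (q + p); rewrite /phase_transform /integral3 => ->.
have := h0 (l - k) (q - p); rewrite /phase_transform /integral3 => ->.
rewrite mulr0 addr0 => E; rewrite -[RHS]E; apply: eq_Rintegral => x _.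
rewrite dot3D dot3B addrACA (cosD (dot3 l x + q)).
have -> : dot3 l x - dot3 k x + (q - p) = (dot3 l x + q) - (dot3 k x + p) by ring.
by rewrite cosB; field.
Qed.

Lemma annihilated_lim (h_ : nat -> space R -> R) h g :
  (forall n, annihilated (h_ n)) -> integrable3 g ->
  (forall n x, `|h_ n x| <= g x) -> (forall x, h_ n x @[n --> \oo] --> h x) ->
  annihilated h.
Proof.
move=> ah gi hg hh.
have mh n : measurable_fun setT (h_ n).
  by apply/measurable_EFinP; have [+ _] := ah n; exact: measurable_int.
split; first by have [] := integral3_cvg mh gi hg hh.
move=> k p; have [||||_] := @integral3_cvg (fun n x => h_ n x * cos (dot3 k x + p))
  (fun x => h x * cos (dot3 k x + p)) g.
- by move=> n; apply: measurable_funM => //; exact: measurable_cos_dot3.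
- exact: gi.
- by move=> n x; rewrite normrM (le_trans _ (hg n x))// ler_piMr// normr_cos_le1.
- by move=> x; apply: cvgM; [exact: hh|exact: cvg_cst].
rewrite /phase_transform => /cvg_lim <-//; apply: lim_near_cst => //; apply: nearW => n.
by have [_ /(_ k p)] := ah n.
Qed.

(* [(1 - u ^ n) ^ (n 2 ^ n)] is a trigonometric polynomial when [u] is one, and
   tends boundedly to the indicator of [u < 1 / 2]. *)
Lemma annihilated_lt0 h l q : annihilated h ->
  annihilated (fun x => h x * (cos (dot3 l x + q) < 0)%R%:R).
Proof.
(* This rescaling maps the cosine into [[0, 1]] and puts its sign change at [1 / 2], the threshold
   of [cvg_step]. *)
move=> ah; pose u x := (1 + cos (dot3 l x + q)) / 2.
have u01 x : 0 <= u x <= 1.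
  have := cos_geN1 (dot3 l x + q); have := cos_le1 (dot3 l x + q).
  by rewrite /u => ? ?; apply/andP; split; lra.
have au g : annihilated g -> annihilated (fun x => g x * u x).
  move=> ag; have := annihilatedB (annihilatedZ 2^-1 ag)
    (annihilatedZ (- 2^-1) (annihilated_cos l q ag)).
  by congr annihilated; apply/funext => x; rewrite /u; field.
have aun n g : annihilated g -> annihilated (fun x => g x * u x ^+ n).
  move=> ag; elim: n => [|n /au]; last first.
    by congr annihilated; apply/funext => x; rewrite exprSr mulrA.
  by move: ag; congr annihilated; apply/funext => x; rewrite expr0 mulr1.
have aunm n m : annihilated (fun x => h x * (1 - u x ^+ n) ^+ m).
  elim: m => [|m ih].
    by move: ah; congr annihilated; apply/funext => x; rewrite expr0 mulr1.
  have := annihilatedB ih (aun n _ ih).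
  by congr annihilated; apply/funext => x; rewrite exprSr; ring.
have [hi _] := ah.
apply: (@annihilated_lim (fun n x => h x * (1 - u x ^+ n) ^+ (n * 2 ^ n)) _
  (fun x => `|h x|)) => //.
- exact: integrable_abse hi.
- move=> n x; rewrite normrM ler_piMr// normrX exprn_ile1//.
  have /andP[? ?] := u01 x.
  rewrite ger0_norm ?lerBlDr ?lerDl ?subr_ge0 ?exprn_ge0//.
  by rewrite exprn_ile1.
- move=> x; apply: cvgM; first exact: cvg_cst.
  have -> : (cos (dot3 l x + q) < 0) = (u x < 2^-1).
    by rewrite /u; apply/idP/idP => ?; lra.
  exact: cvg_step.
Qed.

(* The half-space is the limit of its periodization as the period grows. *)
Lemma annihilated_half_space h v (a : R) : annihilated h ->
  annihilated (fun x => h x * (a < dot3 v x)%R%:R).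
Proof.
move=> ah; have [hi _] := ah.
(* With this phase the cosine is [- sin ((dot3 v x - a) / (n + 1))], negative exactly when
   [a < dot3 v x] once the argument is below [pi] in absolute value. *)
pose q n : R := - (n.+1%:R^-1 * a) + pi / 2.
apply: (@annihilated_lim
  (fun n x => h x * (cos (dot3 (n.+1%:R^-1 *: v) x + q n) < 0)%R%:R) _
  (fun x => `|h x|)) => //.
- by move=> n; exact: annihilated_lt0.
- exact: integrable_abse hi.
- by move=> n x; rewrite normrM ler_piMr// ger0_norm//; case: (_ < _).
- move=> x; apply: cvgM; first exact: cvg_cst.
  apply: cvg_near_cst.
  pose d := dot3 v x - a.
  have cE n : cos (dot3 (n.+1%:R^-1 *: v) x + q n) = - sin (n.+1%:R^-1 * d).
    by rewrite dot3Zl /q addrA -mulrBr cosDpihalf.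
  have : `|d| * n.+1%:R^-1 @[n --> \oo] --> (0 : R).
    by rewrite -(mulr0 `|d|); apply: cvgM; [exact: cvg_cst|exact: cvg_harmonic].
  move=> /cvgrPdist_lt /(_ pi (pi_gt0 R)); apply: filterS => n.
  rewrite sub0r normrN ger0_norm ?mulr_ge0// mulrC => dn.
  rewrite cE oppr_lt0 -(subr_gt0 a) -/d.
  have n0 : 0 < n.+1%:R^-1 :> R by rewrite invr_gt0 ltr0n.
  have [d0|d0|d0] := ltgtP 0 d.
  + by rewrite sin_gt0_pi// mulr_gt0//= -(ger0_norm (ltW d0)).
  + have : 0 < sin (- (n.+1%:R^-1 * d)).
      by rewrite sin_gt0_pi// -mulrN mulr_gt0 ?oppr_gt0//= -(ltr0_norm d0).
    by rewrite sinN oppr_gt0 => sd; rewrite ltNge ltW.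
  + by rewrite -d0 mulr0 sin0 ltxx.
Qed.

End PhaseTransform.

(** * Injectivity of the Fourier transform on integrable functions *)

Section Injectivity.
Context {R : realType}.
Implicit Types (h : space R -> R) (E : set (space R)).

(** Quantifying over [h] lets restrictions be composed, so that these sets form a sigma-algebra and
    not only a Dynkin class. *)
Definition annihilation_stable E :=
  forall h, annihilated h -> annihilated (fun x => h x * \1_E x).

(** Finite unions come from [h 1_B + (h - h 1_B) 1_A], countable ones from dominated convergence
    along partial unions. *)
Lemma annihilation_stable_sigma_algebra : sigma_algebra setT annihilation_stable.
Proof.
have s0 : annihilation_stable set0.
  move=> h /(annihilatedZ 0); congr annihilated; apply/funext => x.
  by rewrite indic0 mulr0 mul0r.
split=> // [A sA h ah|A sA].
  have := annihilatedB ah (sA h ah); congr annihilated; apply/funext => x.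
  by rewrite setTD !indicE in_setC; case: (x \in A) => /=; ring.
pose B n := \big[setU/set0]_(i < n) A i.
have sB n : annihilation_stable (B n).
  elim: n => [|n ih h ah]; first by rewrite /B big_ord0.
  have := annihilatedB (ih h ah)
    (annihilatedZ (-1) (sA n _ (annihilatedB ah (ih h ah)))).
  congr annihilated; apply/funext => x.
  have -> : B n.+1 = B n `|` A n by rewrite /B big_ord_recr.
  rewrite !indicE in_setU; case: (x \in B n); case: (x \in A n) => /=; ring.
move=> h ah; have [hi _] := ah.
apply: (@annihilated_lim _ (fun n x => h x * \1_(B n) x) _ (fun x => `|h x|)).
- by move=> n; exact: sB.
- exact: integrable_abse hi.
- by move=> n x; rewrite normrM ler_piMr// ger0_norm indicE; case: (_ \in _).
- move=> x; apply: cvgM; first exact: cvg_cst.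
  apply: cvg_near_cst.
  have [[m _ Amx]|nAx] := pselect ((\bigcup_k A k) x).
    exists m.+1 => // n /= mn; rewrite !indicE !mem_set//.
      by exists m.
    by rewrite /B -bigcup_mkord; exists m.
  apply: nearW => n; rewrite !indicE !memNset//.
  by rewrite /B -bigcup_mkord => -[m _ Amx]; apply: nAx; exists m.
Qed.

Lemma half_space_stable (v : space R) (a : R) :
  annihilation_stable [set x | a < dot3 v x].
Proof.
move=> h /(@annihilated_half_space _ _ v a); congr annihilated.
apply/funext => x; rewrite indicE; congr (_ * _%:R).
by congr nat_of_bool; apply/idP/idP; rewrite inE.
Qed.

(** Coordinates are dot products with basis vectors, so half-spaces make the identity measurable
    from the sigma-algebra generated by the stable sets. That sigma-algebra contains only stable
    sets. *)
Lemma measurable_annihilation_stable E : measurable E -> annihilation_stable E.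
Proof.
pose T := g_sigma_algebraType annihilation_stable.
have mid : measurable_fun [set: T] (id : T -> space R).
  have mdot (v : space R) : measurable_fun [set: T] (dot3 v : T -> R).
    apply: (measurability _ (RGenOInfty.measurableE R)) => _ [_ [a ->] <-].
    apply: sub_sigma_algebra; have := @half_space_stable v a.
    congr annihilation_stable; apply/seteqP; split => x /=.
      by rewrite in_itv/= andbT.
    by rewrite in_itv/= andbT => -[].
  have -> : (id : T -> space R) = (fun x : T =>
      (dot3 (1, 0, 0) (x : space R), dot3 (0, 1, 0) (x : space R), dot3 (0, 0, 1) (x : space R))).
    apply/funext => -[[x y] z]; rewrite /dot3 /=.
    by rewrite !mul1r !mul0r !addr0 !add0r.
  apply: measurable_fun_pair; first apply: measurable_fun_pair; exact: mdot.
move=> mE; have := mid measurableT E mE; rewrite setTI preimage_id.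
move=> /(_ annihilation_stable); apply; split; last by [].
exact: annihilation_stable_sigma_algebra.
Qed.

(** At frequency and phase 0 the transform of [h] restricted to [E] is the integral of [h] over [E],
    so all these integrals vanish. *)
Lemma annihilated_ae0 h : annihilated h -> {ae lebesgue3 R, forall x, h x = 0}.
Proof.
move=> ah; have [hi _] := ah.
have : ae_eq (lebesgue3 R) setT (EFin \o h) (cst 0%E).
  apply: integral_ae_eq => // E _ mE.
  have [hEi /(_ 0 0)] := measurable_annihilation_stable mE ah.
  rewrite /phase_transform /integral3.
  under eq_Rintegral => x _.
    have -> : dot3 0 x + 0 = 0 by rewrite /dot3 /=; ring.
    rewrite cos0 mulr1; over.
  move=> h0; rewrite integral0 integral_mkcond -[LHS]fineK; last first.
    apply: integrable_fin_num => //; apply: (eq_integrable measurableT _ _ _ hEi) => // x _.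
    by rewrite /= patchE indicE; case: ifPn => _; rewrite /= ?mulr1 ?mulr0.
  congr EFin; rewrite -[RHS]h0; congr fine; apply: eq_integral => x _.
  by rewrite /= patchE indicE; case: ifPn => _; rewrite /= ?mulr1 ?mulr0.
apply: filterS => x /= /(_ I) E; exact: EFin_inj E.
Qed.

End Injectivity.

(** * Density of full-measure sets; continuity, measurability and bounds of transforms *)

Section Regularity.
Context {R : realType}.
Implicit Types (h g : space R -> R) (k x : space R).

Lemma lebesgue_ball_gt0 (a e : R) : 0 < e ->
  (0 < lebesgue_measure (`](a - e)%R, (a + e)%R[%classic : set R))%E.
Proof.
move=> e0; rewrite lebesgue_measure_itv/= lte_fin.
by rewrite ltrBlDr -addrA ltrDl addr_gt0// -EFinB lte_fin; lra.
Qed.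

(** An open box has positive measure, so the null exceptional set cannot contain it. *)
Lemma ae3_dense (P : space R -> Prop) k (e : R) :
  {ae lebesgue3 R, forall x, P x} -> 0 < e ->
  exists x, [/\ P x, `|k.1.1 - x.1.1| < e, `|k.1.2 - x.1.2| < e & `|k.2 - x.2| < e].
Proof.
move=> [N [mN N0 PN]] e0; apply: contrapT => nex.
pose I (a : R) : set (measurableTypeR R) := `](a - e), (a + e)[%classic.
have mI a : measurable (I a) by exact: measurable_itv.
have mIX a b : measurable (I a `*` I b) by exact: measurableX.
have I0 a : (0 < lebesgue_measure (I a))%E by exact: lebesgue_ball_gt0.
have IX a b : (0 < (lebesgue_measure \x lebesgue_measure) (I a `*` I b))%E.
  by rewrite (product_measure1E _ _ (mI a) (mI b)) mule_gt0//; exact: I0.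
have : (0 < (lebesgue3 R) ((I k.1.1 `*` I k.1.2) `*` I k.2))%E.
  by rewrite (product_measure1E _ _ (mIX _ _) (mI _)) mule_gt0//; (exact: IX || exact: I0).
apply/negP; rewrite -leNgt -N0; apply: le_measure; rewrite ?inE//.
  exact: measurableX (mIX _ _) (mI _).
move=> x [[/= x1 x2] x3]; apply: PN => /= Px; apply: nex; exists x.
by move: x1 x2 x3; rewrite /I /= !in_itv/= => x1 x2 x3; split=> //; rewrite distrC ltr_distl.
Qed.

(** Carries almost-everywhere information to a single frequency. Convergence is expressed by [dot3],
    through which frequencies enter the transforms. *)
Lemma ae3_cvg (P : space R -> Prop) k : {ae lebesgue3 R, forall x, P x} ->
  exists k_ : nat -> space R, (forall n, P (k_ n)) /\
    forall x, dot3 (k_ n) x @[n --> \oo] --> dot3 k x.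
Proof.
move=> aeP.
have /choice[k_ k_P] : forall n, exists x, [/\ P x, `|k.1.1 - x.1.1| < n.+1%:R^-1,
    `|k.1.2 - x.1.2| < n.+1%:R^-1 & `|k.2 - x.2| < n.+1%:R^-1].
  by move=> n; apply: ae3_dense => //; rewrite invr_gt0 ltr0n.
exists k_; split => [n|x]; first by have [] := k_P n.
have cv (f : space R -> R) : (forall n, `|f k - f (k_ n)| < n.+1%:R^-1) ->
    f (k_ n) @[n --> \oo] --> f k.
  move=> fk; apply/cvgrPdist_lt => e e0.
  have := @cvg_harmonic R => /cvgrPdist_lt /(_ e e0); apply: filterS => n.
  rewrite sub0r normrN ger0_norm; last by rewrite invr_ge0.
  exact: lt_trans.
apply: cvgD; first apply: cvgD.
- apply: cvgM; last exact: cvg_cst.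
  by apply: (cv (fun k => k.1.1)) => n; have [] := k_P n.
- apply: cvgM; last exact: cvg_cst.
  by apply: (cv (fun k => k.1.2)) => n; have [] := k_P n.
- apply: cvgM; last exact: cvg_cst.
  by apply: (cv (fun k => k.2)) => n; have [] := k_P n.
Qed.

Lemma cvg_phase_transform h (k_ : nat -> space R) k p : integrable3 h ->
  (forall x, dot3 (k_ n) x @[n --> \oo] --> dot3 k x) ->
  phase_transform h (k_ n) p @[n --> \oo] --> phase_transform h k p.
Proof.
move=> hi kk; have [||||_] := @integral3_cvg R (fun n x => h x * cos (dot3 (k_ n) x + p))
  (fun x => h x * cos (dot3 k x + p)) (fun x => `|h x|) => //.
- move=> n; apply: measurable_funM; last exact: measurable_cos_dot3.
  by apply/measurable_EFinP; exact: measurable_int hi.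
- exact: integrable_abse hi.
- by move=> n x; rewrite normrM ler_piMr// normr_cos_le1.
- move=> x; apply: cvgM; first exact: cvg_cst.
  apply: continuous_cvg; first exact: continuous_cos.
  by apply: cvgD; [exact: kk|exact: cvg_cst].
Qed.

(** Continuity extends the vanishing to every [k]; the addition formula for the cosine then reaches
    every phase from the two given. *)
Lemma phase_transform_inj h : integrable3 h ->
  {ae lebesgue3 R, forall k,
     phase_transform h k 0 = 0 /\ phase_transform h k (- (pi / 2)) = 0} ->
  {ae lebesgue3 R, forall x, h x = 0}.
Proof.
move=> hi h0; apply: annihilated_ae0; split => // k p.
have [k_ [k_0 k_k]] := ae3_cvg k h0.
have h00 q : (forall n, phase_transform h (k_ n) q = 0) -> phase_transform h k q = 0.
  move=> hq; have /cvg_lim <-// := cvg_phase_transform (p := q) hi k_k.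
  by apply: lim_near_cst => //; apply: nearW.
have := RintegralB (mu := lebesgue3 R) measurableT
  (integrable3Z (cos p) (integrable3_cos k 0 hi))
  (integrable3Z (sin p) (integrable3_cos k (- (pi / 2)) hi)).
rewrite !RintegralZl; [|exact: measurableT|exact: integrable3_cos|
  exact: measurableT|exact: integrable3_cos].
have := h00 0 (fun n => (k_0 n).1); rewrite /phase_transform /integral3 => ->.
have := h00 _ (fun n => (k_0 n).2); rewrite /phase_transform /integral3 => ->.
rewrite !mulr0 subr0 => E; rewrite -[RHS]E; apply: eq_Rintegral => x _.
by rewrite addr0 cosBpihalf cosD; ring.
Qed.

Lemma measurable_dot3_pair :
  measurable_fun [set: space R * space R] (fun z => dot3 z.1 z.2).
Proof.
have m1 := @measurable_fst _ _ (space R) (space R).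
have m2 := @measurable_snd _ _ (space R) (space R).
apply: measurable_funD; first apply: measurable_funD.
- apply: measurable_funM.
    exact: measurableT_comp measurable_coord1 m1.
  exact: measurableT_comp measurable_coord1 m2.
- apply: measurable_funM.
    exact: measurableT_comp measurable_coord2 m1.
  exact: measurableT_comp measurable_coord2 m2.
- apply: measurable_funM.
    exact: measurableT_comp measurable_coord3 m1.
  exact: measurableT_comp measurable_coord3 m2.
Qed.

(** Raising the cosine by 1 makes the integrand non-negative, as Tonelli's theorem requires; the
    constant [integral3 g] is subtracted afterwards. *)
Lemma measurable_phase_transform_ge0 g p : integrable3 g -> (forall x, 0 <= g x) ->
  measurable_fun setT (phase_transform g ^~ p).
Proof.
move=> gi g0.
have mg : measurable_fun setT g by apply/measurable_EFinP; exact: measurable_int gi.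
pose f (z : space R * space R) := (g z.2 * (1 + cos (dot3 z.1 z.2 + p)))%:E.
have f0 z : (0 <= f z)%E.
  by rewrite lee_fin mulr_ge0//; have := cos_geN1 (dot3 z.1 z.2 + p); lra.
have mf : measurable_fun setT f.
  apply/measurable_EFinP; apply: measurable_funM.
    exact: measurableT_comp mg (@measurable_snd _ _ (space R) (space R)).
  apply: measurable_funD => //; apply: measurableT_comp.
    exact: continuous_measurable_fun (@continuous_cos R).
  by apply: measurable_funD => //; exact: measurable_dot3_pair.
have mF : measurable_fun setT (fun k => (\int[lebesgue3 R]_x f (k, x))%E).
  exact: measurable_integral3 mf f0.
have -> : phase_transform g ^~ p = fun k => fine (\int[lebesgue3 R]_x f (k, x))%E - integral3 g.
  apply/funext => k; apply/eqP; rewrite eq_sym subr_eq eq_sym; apply/eqP.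
  rewrite addrC -[RHS]/(integral3 (fun x => g x * (1 + cos (dot3 k x + p)))).
  rewrite -RintegralD//; last exact: integrable3_cos.
  by apply: eq_Rintegral => x _; rewrite mulrDr mulr1.
apply: measurable_funB => //.
exact: measurableT_comp (fine_measurable measurableT) mF.
Qed.

Lemma measurable_phase_transform h p : integrable3 h ->
  measurable_fun setT (phase_transform h ^~ p).
Proof.
move=> hi.
have ip : integrable3 (h^\+) by exact: integrable_funrpos.
have im : integrable3 (h^\-) by exact: integrable_funrneg.
have -> : phase_transform h ^~ p =
    (fun k => phase_transform h^\+ k p - phase_transform h^\- k p).
  apply/funext => k; rewrite -phase_transformB//; congr (phase_transform _ k p).
  by apply/funext => x; rewrite -{1}(funrposBneg h).
by apply: measurable_funB; apply: measurable_phase_transform_ge0.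
Qed.

Lemma phase_transform_le h k p : integrable3 h ->
  `|phase_transform h k p| <= integral3 (fun x => `|h x|).
Proof.
move=> hi; have ic := integrable3_cos k p hi.
apply: le_trans (le_normr_Rintegral measurableT ic) _.
apply: le_Rintegral => //; [exact: integrable_abse ic|exact: integrable_abse hi|].
by move=> x _; rewrite normrM ler_piMr// normr_cos_le1.
Qed.

End Regularity.

(** * Local integrability of negative powers of the Euclidean norm *)

Section WeightNearZero.
Context {R : realType}.
Implicit Types (k : space R).

Lemma enorm3_ge0 k : 0 <= enorm3 k. Proof. exact: sqrtr_ge0. Qed.

Lemma coord_le_enorm3 k :
  [/\ `|k.1.1| <= enorm3 k, `|k.1.2| <= enorm3 k & `|k.2| <= enorm3 k].
Proof.
by split; rewrite -sqrtr_sqr ler_wsqrtr// /dot3;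
  have := sqr_ge0 k.1.1; have := sqr_ge0 k.1.2; have := sqr_ge0 k.2; rewrite !expr2; lra.
Qed.

Lemma enorm3_eq0 k : enorm3 k = 0 -> k = 0.
Proof.
move=> k0; have := coord_le_enorm3 k; rewrite k0 !normr_le0.
by case: k {k0} => -[? ?] ? /= [/eqP-> /eqP-> /eqP->].
Qed.

Lemma measurable_enorm3 : measurable_fun setT (@enorm3 R).
Proof.
apply: (measurableT_comp (f := @Num.sqrt R) (g := fun k => dot3 k k)).
  by apply: continuous_measurable_fun; exact: sqrt_continuous.
exact: measurableT_comp (@measurable_dot3_pair R)
  (measurable_fun_pair (@measurable_id _ (space R) setT) (@measurable_id _ (space R) setT)).
Qed.

Lemma measurable_enorm3_powR (c : R) :
  measurable_fun setT (fun k => enorm3 k `^ c).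
Proof. exact: measurableT_comp (measurable_powR c) measurable_enorm3. Qed.

Lemma powR_exprn (a c : R) n : 0 <= a -> (a ^+ n) `^ c = (a `^ c) ^+ n.
Proof.
move=> a0; rewrite -powR_mulrn// -powRrM mulrC powRrM powR_mulrn//.
exact: powR_ge0.
Qed.

Definition cube3 (r : R) : set (space R) :=
  (`[- r, r]%classic `*` `[- r, r]%classic) `*` `[- r, r]%classic.

Lemma cube3E r k : cube3 r k <-> [/\ `|k.1.1| <= r, `|k.1.2| <= r & `|k.2| <= r].
Proof.
rewrite /cube3 /= !in_itv/= -!ler_norml.
by split => [[[]]|[]].
Qed.

Lemma measurable_cube3 r : measurable (cube3 r).
Proof. by apply: measurableX; [apply: measurableX|]; exact: measurable_itv. Qed.

Lemma lebesgue3_cube3 r : 0 <= r -> lebesgue3 R (cube3 r) = ((2 * r) ^+ 3)%:E.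
Proof.
move=> r0; pose I : set (measurableTypeR R) := `[- r, r]%classic.
have mI : measurable I by exact: measurable_itv.
have IE : lebesgue_measure I = (2 * r)%:E.
  rewrite lebesgue_measure_itv/= lte_fin.
  case: ifPn => [_|]; first by rewrite -EFinB; congr EFin; ring.
  by rewrite -leNgt => ?; congr EFin; lra.
have IIE : (lebesgue_measure \x lebesgue_measure)%E (I `*` I) = (2 * r * (2 * r))%:E.
  by rewrite EFinM -IE; exact: product_measure1E.
transitivity ((2 * r * (2 * r))%:E * (2 * r)%:E)%E; last first.
  by rewrite -EFinM; congr EFin; ring.
by rewrite -IIE -IE; exact: (product_measure1E _ _ (measurableX mI mI) mI).
Qed.

(* On the dyadic shell [2^-(n+1) < |k|_oo <= 2^-n] the weight is at most
   [2^((n+1)c)], and the shell has volume at most [8 * 8^-n]. *)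
Lemma integrable_enorm3_powR (c : R) : 0 < c < 3 ->
  (lebesgue3 R).-integrable (cube3 1) (fun k => (enorm3 k `^ (- c))%:E).
Proof.
move=> /andP[c0 c3]; pose rho := (2^-1 : R) `^ c.
have rho0 : 0 < rho by rewrite powR_gt0// invr_gt0.
(* The ratio [2 ^ (c - 3)] of the bounds on successive shells, below 1 because [c < 3]. *)
pose q := 2^-1 ^+ 3 / rho.
have q0 : 0 <= q by rewrite divr_ge0 ?exprn_ge0 ?invr_ge0// ltW.
have q1 : q < 1.
  rewrite ltr_pdivrMr// mul1r -powR_mulrn ?invr_ge0// -[2^-1]powR_inv1// /rho.
  rewrite -[2^-1]powR_inv1// -!powRrM !mulN1r /powR pnatr_eq0/=.
  by rewrite ltr_expR ltr_pM2r ?ltrN2// ln_gt0// ltr1n.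
pose C n := cube3 (2^-1 ^+ n).
(* The bound for the shell is spread over the whole cube [C n], whose volume is explicit. *)
pose g n k : \bar R := (rho ^- n.+1 * \1_(C n) k)%:E.
have g0 n k : (0 <= g n k)%E.
  by rewrite lee_fin mulr_ge0// ltW// invr_gt0 exprn_gt0.
have mC n : measurable (C n) by exact: measurable_cube3.
have mg n : measurable_fun (cube3 1) (g n).
  apply/measurable_EFinP; apply: measurable_funM => //.
have mw : measurable_fun (cube3 1) (fun k => (enorm3 k `^ (- c))%:E).
  by apply/measurable_EFinP; apply: measurable_funTS; exact: measurable_enorm3_powR.
have wg k : cube3 1 k -> ((enorm3 k `^ (- c))%:E <= \sum_(n <oo) g n k)%E.
  (* At the origin, 0 to a non-zero power is 0 by convention and the bound is trivial. *)
  move=> k1; have [->|/eqP k0] := eqVneq (enorm3 k) 0.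
    by rewrite powR0 ?oppr_eq0 ?gt_eqF//; exact: nneseries_ge0.
  have n0 : 0 < enorm3 k by rewrite lt_neqAle enorm3_ge0 andbT eq_sym; apply/eqP.
  have exn : exists n, ~~ (k \in C n.+1).
    have : 2^-1 ^+ n @[n --> \oo] --> (0 : R).
      by apply: cvg_expr; rewrite ger0_norm ?invr_ge0// invf_lt1// ltr1n.
    have [k0'] : exists e : R, 0 < e /\ forall r, r < e -> ~ cube3 r k.
      have : (0 < `|k.1.1|) || (0 < `|k.1.2|) || (0 < `|k.2|).
        rewrite !normr_gt0; apply: contrapT => /negP; rewrite !negb_or !negbK.
        move=> /andP[/andP[/eqP x0 /eqP y0] /eqP z0]; apply: k0.
        by rewrite /enorm3 /dot3 x0 y0 z0 !mulr0 !addr0 sqrtr0.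
      by case/orP => [/orP[]|] kp; eexists;
        (split; first exact: kp) => r rk /cube3E[]; lra.
    move=> [e0 ek] /cvgrPdist_lt /(_ _ e0) [m _] /(_ m.+1 (leqnSn m)).
    rewrite sub0r normrN ger0_norm ?exprn_ge0 ?invr_ge0// => /ek nC.
    by exists m; apply/negP; rewrite inE.
  (* The least such [n] locates the shell: [k] is in [C n] but not in [C n.+1]; for [n = 0]
     membership is the assumption [cube3 1 k]. *)
  have [n nC nmin] := ex_minnP exn.
  have kC : k \in C n.
    case: n nC nmin => [|n] _ nmin; first by rewrite inE /C expr0.
    by apply: contrapT => /negP /nmin; rewrite ltnn.
  apply: le_trans (nneseries_lim_ge n.+1 _); last by [].
  rewrite big_nat_recr//= -[leLHS]add0e leeD ?sume_ge0//.
  rewrite lee_fin indicE kC mulr1 powRN lef_pV2 ?posrE ?exprn_gt0 ?powR_gt0//.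
  rewrite -powR_exprn ?invr_ge0//.
  apply: ge0_ler_powR; rewrite ?nnegrE ?exprn_ge0 ?enorm3_ge0 ?invr_ge0 ?ltW//.
  rewrite ltNge; apply/negP => kn; move/negP: nC; apply; rewrite inE.
  have [? ? ?] := coord_le_enorm3 k.
  by apply/cube3E; split; exact: le_trans kn.
apply/integrableP; split=> //.
under eq_integral do rewrite gee0_abs ?lee_fin ?powR_ge0//.
apply: (@le_lt_trans _ _ (\int[lebesgue3 R]_(k in cube3 1) \sum_(n <oo) g n k)%E).
  apply: ge0_le_integral => //; first exact: measurable_cube3.
  - by move=> k _; rewrite lee_fin powR_ge0.
  - by apply: ge0_emeasurable_sum => // n _; exact: mg.
rewrite integral_nneseries//; last exact: measurable_cube3.
(* The sum of the geometric series with terms [8 / rho * q ^+ i], each being [rho ^- i.+1] times the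
   volume of [C i]. *)
apply: (@le_lt_trans _ _ (8 / rho / (1 - q))%:E); last exact: ltry.
apply: lime_le; first by apply: is_cvg_nneseries => n _ _; exact: integral_ge0.
apply: nearW => n.
apply: (@le_trans _ _ (\sum_(0 <= i < n) (8 / rho * q ^+ i)%:E)%E).
  apply: lee_sum => i _.
  under eq_integral => k _ do rewrite /g EFinM.
  rewrite ge0_integralZl_EFin; last 4 first.
  - exact: measurable_cube3.
  - by [].
  - by apply/measurable_EFinP; apply: measurable_indic; exact: mC.
  - by rewrite ltW// invr_gt0 exprn_gt0.
  rewrite integral_indic//; last exact: measurable_cube3.
  apply: (@le_trans _ _ ((rho ^- i.+1)%:E * lebesgue3 R (C i))%E).
    apply: lee_wpmul2l; first by rewrite lee_fin ltW// invr_gt0 exprn_gt0.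
    apply: le_measure; rewrite ?inE; [|exact: mC|exact: subIsetl].
    by apply: measurableI; [exact: mC|exact: (measurable_cube3 1)].
  rewrite lebesgue3_cube3 ?exprn_ge0 ?invr_ge0// -EFinM lee_fin le_eqVlt.
  apply/orP; left; apply/eqP; rewrite /q expr_div_n -exprM mulnC exprM exprS invfM.
  by set x := 2^-1 ^+ i; ring.
  exact: (measurable_cube3 1).
rewrite sumEFin lee_fin -mulr_sumr ler_wpM2l ?divr_ge0 ?(ltW rho0)//.
rewrite -[leRHS]mul1r ler_pdivlMr ?subr_gt0// big_mkord.
have := subrXX 1 q n; rewrite expr1n => E.
have -> : (\sum_(i < n) q ^+ i) * (1 - q) = 1 - q ^+ n.
  by rewrite E mulrC; congr (_ * _); apply: eq_bigr => i _; rewrite expr1n mul1r.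
by rewrite lerBlDr lerDl exprn_ge0.
Qed.

End WeightNearZero.

(** * Almost-everywhere statements in three dimensions *)

Section AlmostEverywhere.
Context {R : realType}.
Implicit Types P Q : space R -> Prop.

Lemma ae3_mono P Q : (forall x, P x -> Q x) ->
  {ae lebesgue3 R, forall x, P x} -> {ae lebesgue3 R, forall x, Q x}.
Proof.
move=> PQ [N [mN N0 PN]]; exists N; split => // x /= nQ.
by apply: PN => /= /PQ.
Qed.

Lemma ae3_and P Q :
  {ae lebesgue3 R, forall x, P x} -> {ae lebesgue3 R, forall x, Q x} ->
  {ae lebesgue3 R, forall x, P x /\ Q x}.
Proof.
move=> aP aQ; have := negligibleU aP aQ; apply: negligibleS => x /= nPQ.
by apply: contrapT => /not_orP[/contrapT Px /contrapT Qx]; exact: nPQ.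
Qed.

Lemma ae3_neq0 : {ae lebesgue3 R, forall k, k != 0}.
Proof.
have m0 : measurable ([set 0] : set (space R)).
  rewrite (_ : [set 0] = ([set 0] `*` [set 0]) `*` [set 0]).
    by apply: measurableX; [apply: measurableX|]; exact: measurable_set1.
  apply/seteqP; split => [x -> //|[[x y] z] /= [[]]].
  by move=> -> -> ->.
exists [set 0]; split => //; last by move=> x /= /negP; rewrite negbK => /eqP.
apply/eqP; rewrite eq_le measure_ge0 andbT; apply/lee_addgt0Pr => e e0; rewrite add0e.
(* Chosen so that the volume satisfies [8 r ^ 3 <= 8 r <= e]. *)
pose r := Num.min 1 (e / 8).
have r0 : 0 < r by rewrite lt_min ltr01 divr_gt0.
apply: (@le_trans _ _ (lebesgue3 R (cube3 r))).
  apply: le_measure; rewrite ?inE//; first exact: measurable_cube3.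
  by move=> _ ->; apply/cube3E; rewrite !normr0; split; exact: ltW.
rewrite (lebesgue3_cube3 (ltW r0)) lee_fin.
have r1 : r <= 1 by rewrite ge_min lexx.
have re : r <= e / 8 by rewrite ge_min lexx orbT.
have : r ^+ 3 <= r by rewrite -[leRHS]expr1 ler_wiXn2l// ltW.
rewrite exprMn; lra.
Qed.

End AlmostEverywhere.

(** * Square-integrable fields of pairs and their inner product *)

Section SquareIntegrableFields.
Context {R : realType}.
Implicit Types (u v w : space R -> R * R).

(** Pairs stand for complex numbers; this is the real part of [a] times the conjugate of [b]. *)
Definition dot2 (a b : R * R) : R := a.1 * b.1 + a.2 * b.2.

Definition square_integrable u :=
  [/\ measurable_fun setT (fun k => (u k).1), measurable_fun setT (fun k => (u k).2)
    & integrable3 (fun k => dot2 (u k) (u k))].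

Definition inner u v := integral3 (fun k => dot2 (u k) (v k)).

Lemma dot2Bl (a : R) x y z : dot2 (x - a *: y) z = dot2 x z - a * dot2 y z.
Proof.
by case: x y z => [x1 x2] [y1 y2] [z1 z2]; rewrite /dot2 /= /GRing.scale /=; ring.
Qed.

Lemma dot2C a b : dot2 a b = dot2 b a. Proof. by rewrite /dot2; ring. Qed.

Lemma dot2_ge0 a : 0 <= dot2 a a.
Proof. by rewrite /dot2 -!expr2 addr_ge0 ?sqr_ge0. Qed.

Lemma dot2_eq0 a : dot2 a a = 0 -> a = 0.
Proof.
case: a => x y /eqP; rewrite /dot2 /= -!expr2 paddr_eq0 ?sqr_ge0//.
by rewrite !sqrf_eq0 => /andP[/eqP-> /eqP->].
Qed.

Lemma innerC u v : inner u v = inner v u.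
Proof. by apply: eq_Rintegral => k _; rewrite dot2C. Qed.

Lemma inner_ge0 u : 0 <= inner u u.
Proof. by apply: Rintegral_ge0 => k _; exact: dot2_ge0. Qed.

Lemma measurable_dot2 u v :
  measurable_fun setT (fun k => (u k).1) -> measurable_fun setT (fun k => (u k).2) ->
  measurable_fun setT (fun k => (v k).1) -> measurable_fun setT (fun k => (v k).2) ->
  measurable_fun setT (fun k => dot2 (u k) (v k)).
Proof. by move=> *; apply: measurable_funD; apply: measurable_funM. Qed.

Lemma square_integrable_dot2 u v : square_integrable u -> square_integrable v ->
  integrable3 (fun k => dot2 (u k) (v k)).
Proof.
move=> [u1 u2 ui] [v1 v2 vi].
apply: (le_integrable measurableT _ _ (integrable3D ui vi)).
  by apply/measurable_EFinP; exact: measurable_dot2.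
move=> k _ /=; rewrite lee_fin (ger0_norm (addr_ge0 (dot2_ge0 _) (dot2_ge0 _))).
rewrite /dot2 ler_norml; case: (u k) (v k) => [a b] [c d] /=.
have := sqr_ge0 (a - c); have := sqr_ge0 (b - d).
have := sqr_ge0 (a + c); have := sqr_ge0 (b + d).
have := sqr_ge0 a; have := sqr_ge0 b; have := sqr_ge0 c; have := sqr_ge0 d.
by rewrite !expr2 => *; apply/andP; split; lra.
Qed.

Lemma square_integrableB (a : R) u v : square_integrable u -> square_integrable v ->
  square_integrable (fun k => u k - a *: v k).
Proof.
move=> su sv; have [u1 u2 ui] := su; have [v1 v2 vi] := sv; split.
- by apply: measurable_funB => //; exact: measurable_funM.
- by apply: measurable_funB => //; exact: measurable_funM.
have := integrable3D (integrable3B ui (integrable3Z (2 * a) (square_integrable_dot2 su sv)))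
  (integrable3Z (a ^+ 2) vi).
apply: eq_integrable => // k _ /=; congr EFin.
by rewrite dot2Bl !(dot2C _ (_ - _)) !dot2Bl (dot2C (v k) (u k)); ring.
Qed.

Lemma innerBl (a : R) u v w :
  square_integrable u -> square_integrable v -> square_integrable w ->
  inner (fun k => u k - a *: v k) w = inner u w - a * inner v w.
Proof.
move=> su sv sw; have uw := square_integrable_dot2 su sw.
have vw := square_integrable_dot2 sv sw.
rewrite /inner /integral3 -RintegralZl// -RintegralB//; last exact: integrable3Z.
by apply: eq_Rintegral => k _; rewrite dot2Bl.
Qed.

Lemma innerBr (a : R) u v w :
  square_integrable u -> square_integrable v -> square_integrable w ->
  inner w (fun k => u k - a *: v k) = inner w u - a * inner w v.
Proof. by move=> *; rewrite innerC innerBl// !(innerC w). Qed.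

Lemma integral3_ae (F G : space R -> R) : measurable_fun setT F -> measurable_fun setT G ->
  {ae lebesgue3 R, forall x, F x = G x} -> integral3 F = integral3 G.
Proof.
move=> mF mG FG; congr fine; apply: ae_eq_integral => //.
- exact/measurable_EFinP.
- exact/measurable_EFinP.
- by move: FG; apply: ae3_mono => x FGx _ /=; rewrite FGx.
Qed.

(** Serves for residuals of projections, whose squared norm is a Gram determinant, assumed
    non-positive, over a positive number. *)
Lemma inner_le0 u : square_integrable u -> inner u u <= 0 ->
  {ae lebesgue3 R, forall k, u k = 0}.
Proof.
move=> [u1 u2 ui] u0.
have : (\int[lebesgue3 R]_k `|(dot2 (u k) (u k))%:E| = 0)%E.
  under eq_integral do rewrite gee0_abs ?lee_fin ?dot2_ge0//.
  rewrite -[LHS]fineK; last exact: integrable_fin_num.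
  by congr EFin; apply/eqP; rewrite eq_le u0 inner_ge0.
move=> /(ae_eq_integral_abs (lebesgue3 R) measurableT); case.
  by apply/measurable_EFinP; exact: measurable_dot2.
move=> N [mN N0 uN]; exists N; split => // k /= nuk; apply: uN => /= uk; apply: nuk.
by apply: dot2_eq0; exact: (EFin_inj (uk I)).
Qed.

End SquareIntegrableFields.

(** * Sobolev products as inner products of weighted transforms *)

Section SobolevProducts.
Context {R : realType}.
Implicit Types (h f g : space R -> R) (k : space R) (s : R).

Definition fourier_pair h k : R * R :=
  (phase_transform h k 0, phase_transform h k (- (pi / 2))).

(** The factor [(2 pi) ^- 3] is split evenly, so that for [s != 0] the Sobolev product of order [s]
    pairs any two weights with exponents adding up to [2 s]. *)
Definition weighted_fourier s h k : R * R :=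
  (Num.sqrt ((2 * pi) ^- 3) * enorm3 k `^ s) *: fourier_pair h k.

Lemma fourierE h k :
  fourier h k = ((fourier_pair h k).1 +i* (fourier_pair h k).2)%C.
Proof.
rewrite /fourier /cintegral3 /fourier_pair /phase_transform /=.
congr (_ +i* _)%C; apply: eq_Rintegral => x _ /=.
  by rewrite mul0r subr0 addr0.
by rewrite mul0r addr0 cosBpihalf.
Qed.

(** The condition [s != 0] matters at [k = 0]: there 0 to the power 0 is 1, and exponents need not
    add. *)
Lemma weightE s1 s2 s k : s1 + s2 = 2 * s -> s != 0 ->
  (Num.sqrt ((2 * pi) ^- 3) * enorm3 k `^ s1) * (Num.sqrt ((2 * pi) ^- 3) * enorm3 k `^ s2)
  = (2 * pi) ^- 3 * enorm3 k `^ (2 * s).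
Proof.
move=> s12 s0; rewrite -s12 powRD; last first.
  by apply/implyP; rewrite s12 mulf_eq0 pnatr_eq0/= (negbTE s0).
rewrite mulrACA -expr2 sqr_sqrtr// invr_ge0 exprn_ge0// mulr_ge0//.
exact: pi_ge0.
Qed.

Lemma dot2Z (a b : R) (x y : R * R) : dot2 (a *: x) (b *: y) = a * b * dot2 x y.
Proof.
by case: x y => [x1 x2] [y1 y2]; rewrite /dot2 /= /GRing.scale /=; ring.
Qed.

Lemma Re_sobolev_density s1 s2 s f g k : s1 + s2 = 2 * s -> s != 0 ->
  complex.Re (sobolev_density s f g k) =
  dot2 (weighted_fourier s1 f k) (weighted_fourier s2 g k).
Proof.
move=> s12 s0; rewrite /sobolev_density !fourierE /= /weighted_fourier dot2Z.
by rewrite (weightE _ s12 s0) /dot2 /=; ring.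
Qed.

Lemma Re_sobolev s1 s2 s f g : s1 + s2 = 2 * s -> s != 0 ->
  complex.Re (sobolev s f g) = inner (weighted_fourier s1 f) (weighted_fourier s2 g).
Proof.
by move=> s12 s0; apply: eq_Rintegral => k _; exact: Re_sobolev_density.
Qed.

Lemma measurable_weighted_fourier s h : integrable3 h ->
  measurable_fun setT (fun k => (weighted_fourier s h k).1) /\
  measurable_fun setT (fun k => (weighted_fourier s h k).2).
Proof.
move=> hi; split; apply: measurable_funM; try exact: measurable_phase_transform;
  by apply: measurable_funM => //; exact: measurable_enorm3_powR.
Qed.

Lemma in_sobolev_square_integrable s h : s != 0 -> in_sobolev s h ->
  square_integrable (weighted_fourier s h).
Proof.
move=> s0 [hi si]; have [? ?] := measurable_weighted_fourier s hi; split => //.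
apply: eq_integrable si => // k _ /=; congr EFin; apply: Re_sobolev_density => //.
by ring.
Qed.

(** In the unit cube the transform is bounded by the integral of [|h|], and [|k| ^ (2 s')] is
    integrable because [2 s' > -3]. Outside, [|k| >= 1] and the larger exponent [s] dominates. *)
Lemma square_integrable_low s s' h : s != 0 -> s' < s -> - (3 / 2) < s' < 0 -> integrable3 h ->
  square_integrable (weighted_fourier s h) ->
  square_integrable (weighted_fourier s' h).
Proof.
move=> s00 ss' /andP[s'3 s'0] hi [_ _ si].
have [? ?] := measurable_weighted_fourier s' hi; split => //.
pose M := integral3 (fun x => `|h x|).
have M0 : 0 <= M by apply: Rintegral_ge0.
pose A := 2 * M ^+ 2 * (2 * pi) ^- 3.
have A0 : 0 <= A.
  by rewrite mulr_ge0 ?mulr_ge0 ?sqr_ge0 ?invr_ge0 ?exprn_ge0 ?mulr_ge0// pi_ge0.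
pose low k := (fun k => enorm3 k `^ (- (- (2 * s')))) \_ (cube3 1) k.
have ilow : integrable3 low.
  have c3 : 0 < - (2 * s') < 3 by apply/andP; split; lra.
  suff: (lebesgue3 R).-integrable setT ((fun k => (enorm3 k `^ (- (- (2 * s'))))%:E) \_ (cube3 1)).
    apply: eq_integrable => // k _ /=; rewrite /low patchE /=.
    by rewrite patchE; case: ifP.
  apply: (iffLR (integrable_mkcond _ _)); first exact: (measurable_cube3 1).
  exact: integrable_enorm3_powR.
have := integrable3D (integrable3Z A ilow) si.
apply: le_integrable => //; first by apply/measurable_EFinP; exact: measurable_dot2.
move=> k _ /=; rewrite lee_fin !ger0_norm ?dot2_ge0//; last first.
  rewrite addr_ge0 ?dot2_ge0// mulr_ge0// /low patchE; case: ifP => // _.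
  exact: powR_ge0.
have sE t : t != 0 -> dot2 (weighted_fourier t h k) (weighted_fourier t h k) =
    (2 * pi) ^- 3 * enorm3 k `^ (2 * t) * dot2 (fourier_pair h k) (fourier_pair h k).
  move=> t0; rewrite /weighted_fourier dot2Z (@weightE t t t)//.
  by ring.
have pi3 : 0 <= (2 * pi) ^- 3 :> R by rewrite invr_ge0 exprn_ge0// mulr_ge0// pi_ge0.
have [k1|k1] := boolP (k \in cube3 1).
  rewrite -[leLHS]addr0 lerD ?dot2_ge0// sE ?lt_eqF//.
  rewrite /low patchE k1 opprK /A.
  have dM : dot2 (fourier_pair h k) (fourier_pair h k) <= 2 * M ^+ 2.
    rewrite /dot2 mulr_natl mulr2n -!expr2.
    by apply: lerD; rewrite -real_normK ?num_real// lerXn2r ?nnegrE//; exact: phase_transform_le.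
  have := ler_wpM2l (mulr_ge0 pi3 (powR_ge0 (enorm3 k) (2 * s'))) dM.
  by move=> /le_trans; apply; rewrite le_eqVlt; apply/orP; left; apply/eqP; ring.
rewrite -[leLHS]add0r lerD//.
  by rewrite /low patchE (negbTE k1) mulr0.
have k1' : 1 <= enorm3 k.
  rewrite leNgt; apply/negP => /ltW kl; move/negP: k1; apply; rewrite inE.
  by have [? ? ?] := coord_le_enorm3 k; apply/cube3E; split; exact: le_trans kl.
rewrite (sE s s00) (sE s') ?lt_eqF//; apply: ler_wpM2r; first exact: dot2_ge0.
apply: ler_wpM2l => //.
by apply: ler_powR => //; lra.
Qed.

End SobolevProducts.

(** * Gram determinants of two modes *)

Section GramDeterminant.
Context {R : realType}.
Implicit Types (u v : space R -> R * R) (d f g h : space R -> R) (k : space R) (s t : R).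

Lemma fourier_pairB (c : R) f g k : integrable3 f -> integrable3 g ->
  fourier_pair (fun x => f x - c * g x) k = fourier_pair f k - c *: fourier_pair g k.
Proof.
move=> fi gi; have cgi := integrable3Z c gi.
by rewrite /fourier_pair !phase_transformB// !phase_transformZ.
Qed.

Lemma weighted_fourierB s (c : R) f g k : integrable3 f -> integrable3 g ->
  weighted_fourier s (fun x => f x - c * g x) k =
  weighted_fourier s f k - c *: weighted_fourier s g k.
Proof.
move=> fi gi; rewrite /weighted_fourier fourier_pairB// scalerBr !scalerA.
by rewrite (mulrC c).
Qed.

Lemma enorm3_gt0 k : k != 0 -> 0 < enorm3 k.
Proof.
move=> k0; rewrite lt_neqAle enorm3_ge0 andbT eq_sym.
by apply: contra k0 => /eqP /enorm3_eq0 ->.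
Qed.

Lemma sqrt_pi3_gt0 : 0 < Num.sqrt ((2 * pi) ^- 3) :> R.
Proof. by rewrite sqrtr_gt0 invr_gt0 exprn_gt0// mulr_gt0// pi_gt0. Qed.

Lemma weighted_fourier_eq0 s h k : k != 0 -> weighted_fourier s h k = 0 ->
  fourier_pair h k = 0.
Proof.
move=> k0 /eqP; rewrite scaler_eq0 mulf_eq0 !gt_eqF ?sqrt_pi3_gt0 ?powR_gt0 ?enorm3_gt0//=.
by move=> /eqP.
Qed.

Lemma weighted_fourier_ae0 s h : integrable3 h ->
  {ae lebesgue3 R, forall k, weighted_fourier s h k = 0} ->
  {ae lebesgue3 R, forall x, h x = 0}.
Proof.
move=> hi /(ae3_and (@ae3_neq0 R)) h0; apply: phase_transform_inj => //.
move: h0; apply: ae3_mono => k [k0 /(weighted_fourier_eq0 k0)].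
by rewrite /fourier_pair => -[-> ->].
Qed.

Lemma phase_transform00 f : phase_transform f 0 0 = integral3 f.
Proof.
apply: eq_Rintegral => x _.
have -> : dot3 0 x + 0 = 0 by rewrite /dot3 /=; ring.
by rewrite cos0 mulr1.
Qed.

Lemma cvg_enorm3 (k_ : nat -> space R) :
  (forall x, dot3 (k_ n) x @[n --> \oo] --> dot3 0 x) ->
  enorm3 (k_ n) @[n --> \oo] --> (0 : R).
Proof.
move=> k0.
have c1 : (k_ n).1.1 @[n --> \oo] --> (0 : R).
  have := k0 (1, 0, 0); rewrite /dot3 /= !mul0r !addr0.
  by under eq_fun do rewrite mulr1 !mulr0 !addr0.
have c2 : (k_ n).1.2 @[n --> \oo] --> (0 : R).
  have := k0 (0, 1, 0); rewrite /dot3 /= !mul0r !addr0.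
  by under eq_fun do rewrite mulr1 !mulr0 addr0 add0r.
have c3 : (k_ n).2 @[n --> \oo] --> (0 : R).
  have := k0 (0, 0, 1); rewrite /dot3 /= !mul0r !addr0.
  by under eq_fun do rewrite mulr1 !mulr0 !add0r.
rewrite -sqrtr0 /enorm3; apply: continuous_cvg; first exact: sqrt_continuous.
rewrite /dot3 (_ : 0 = 0 * 0 + 0 * 0 + 0 * 0 :> R); last by ring.
by apply: cvgD; [apply: cvgD|]; apply: cvgM.
Qed.

(* A nonzero total charge survives at [k = 0], where [|k|^(2 - e)] vanishes. *)
Lemma weighted_fourier_prop_eq0 (e t : R) d f : 0 < e < 1 ->
  integrable3 d -> integrable3 f -> integral3 f != 0 ->
  {ae lebesgue3 R, forall k,
     weighted_fourier 2^-1 d k = t *: weighted_fourier (- (3 / 2) + e) f k} ->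
  t = 0.
Proof.
move=> /andP[e0 e1] di fi f0 /(ae3_and (@ae3_neq0 R)) /(ae3_cvg 0)[k_ [k_P k_0]].
pose M := integral3 (fun x => `|d x|).
have M0 : 0 <= M by apply: Rintegral_ge0.
(* Only the first component is compared, which at [k = 0] is the integral. The common weight divides
   out, since [1 / 2 = (2 - e) + (- 3 / 2 + e)]. *)
have kE n : enorm3 (k_ n) `^ (2 - e) * phase_transform d (k_ n) 0 =
    t * phase_transform f (k_ n) 0.
  have [kn0 /(congr1 fst) /=] := k_P n.
  have kn := enorm3_gt0 kn0.
  have wE : enorm3 (k_ n) `^ 2^-1 =
      enorm3 (k_ n) `^ (2 - e) * enorm3 (k_ n) `^ (- (3 / 2) + e).
    by rewrite -powRD ?(gt_eqF kn) ?implybT//; congr (_ `^ _); field.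
  rewrite wE.
  rewrite /GRing.scale /= /GRing.scale /= => E.
  apply: (@mulfI _ (Num.sqrt ((2 * pi) ^- 3) * enorm3 (k_ n) `^ (- (3 / 2) + e))).
    by rewrite gt_eqF// mulr_gt0 ?sqrt_pi3_gt0 ?powR_gt0.
  rewrite [RHS]mulrCA -E; ring.
have : t * phase_transform f (k_ n) 0 @[n --> \oo] --> t * phase_transform f 0 0.
  by apply: cvgM; [exact: cvg_cst|exact: cvg_phase_transform].
have z : t * phase_transform f (k_ n) 0 @[n --> \oo] --> (0 : R).
  have ck := cvg_enorm3 k_0.
  (* The bound holds once [|k| < 1]: then [|k| ^ (2 - e) <= |k|] because [2 - e >= 1]. *)
  apply/norm_cvg0P; apply: (@squeeze_cvgr _ _ _ _ (cst 0) (fun n => enorm3 (k_ n) * M)).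
  - move/cvgrPdist_lt: (ck) => /(_ 1 ltr01); apply: filterS => n.
    rewrite sub0r normrN ger0_norm ?enorm3_ge0// => kn1.
    rewrite normr_ge0 -kE normrM ger0_norm ?powR_ge0//=.
    have [kn0 _] := k_P n.
    apply: ler_pM; rewrite ?powR_ge0//; last exact: phase_transform_le.
    by apply: ge1r_powR; [rewrite enorm3_gt0//= ltW|lra].
  - exact: cvg_cst.
  - by rewrite -(mul0r M); apply: cvgM => //; exact: cvg_cst.
move=> /cvg_lim E; move/cvg_lim: z; rewrite E// => /(_ _)/eqP.
by rewrite phase_transform00 mulf_eq0 (negbTE f0) orbF => /(_ _)/eqP; apply.
Qed.

Lemma integral3_0 : integral3 (fun=> 0) = 0 :> R.
Proof. by rewrite /integral3 /Rintegral integral0. Qed.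

Lemma inner_ae0 u v : square_integrable u -> square_integrable v ->
  {ae lebesgue3 R, forall k, u k = 0} -> inner u v = 0.
Proof.
move=> [? ? ?] [? ? ?] u0; rewrite -[RHS]integral3_0; apply: integral3_ae => //.
  exact: measurable_dot2.
by move: u0; apply: ae3_mono => k ->; rewrite /dot2 /= !mul0r addr0.
Qed.

(** Horner form is the shape on which [grows_mul] acts. *)
Lemma quartic_det (a b x p p' r m m' n y : R) :
  (a + y ^+ 2 * p - y * (m + m)) * (b + y ^+ 2 * p' - y * (m' + m')) -
  (x + y ^+ 2 * r - y * n) ^+ 2 =
  y * (y * (y * (y * (p * p' - r ^+ 2) + (- (p * (m' + m')) - (m + m) * p' + 2 * r * n))
    + (p * b + (m + m) * (m' + m') + a * p' - n ^+ 2 - 2 * r * x))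
    + (- ((m + m) * b) - a * (m' + m') + 2 * n * x)) + (a * b - x ^+ 2).
Proof. by ring. Qed.

(* Subtracting [c] times the first mode from the second one leaves no field
   part in it, and only the cross term [q' - c q] depends on [y]. *)
Lemma quadratic_det (a x b u p c q q' y : R) :
  (a + u + y ^+ 2 * p - y * (q + q)) *
    (b + c * (c * u) + y ^+ 2 * (c * (c * p)) - y * (c * q' + c * q')) -
  (x + c * u + y ^+ 2 * (c * p) - y * (q' + c * q)) ^+ 2 =
  let a' := b - c * x - c * (x - c * a) in
  let z := x - c * a in
  y * (y * (a' * p - (q' - c * q) ^+ 2) + (- (2 * q * a') + 2 * z * (q' - c * q)))
    + ((a + u) * a' - z ^+ 2).
Proof. by rewrite /=; ring. Qed.

(* Otherwise unification compares distinct inner products by unfolding the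
   Lebesgue integral. *)
Opaque inner.

Section TwoModes.
Variables (e : R) (g f g' f' : space R -> R).
Hypothesis e01 : 0 < e < 1.
Hypotheses (gs : in_sobolev 2^-1 g) (fs : in_sobolev (- 2^-1) f)
  (g's : in_sobolev 2^-1 g') (f's : in_sobolev (- 2^-1) f').

Let G h := weighted_fourier 2^-1 h.
Let B h := weighted_fourier (- 2^-1) h.
Let F h := weighted_fourier (- (3 / 2) + e) h.

Definition covariance (y : R) (a b : phase R) : R :=
  inner (G (gpart a)) (G (gpart b)) + inner (B (fpart a)) (B (fpart b))
  + y ^+ 2 * inner (F (fpart a)) (F (fpart b))
  - y * (inner (F (fpart a)) (G (gpart b)) + inner (F (fpart b)) (G (gpart a))).

Definition covariance_det (y : R) : R :=
  let a := Phase g f in let b := Phase g' f' in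
  covariance y a a * covariance y b b - covariance y a b ^+ 2.

(** The alternatives are linear independence and dependence of [F f] and [F f']; the non-zero
    integral makes [F f] non-zero, so that one can project onto it. *)
Lemma covariance_det_growth : integral3 f != 0 ->
  ~ (exists c : R, {ae lebesgue3 R, forall x, f' x = c * f x /\ g' x = c * g x}) ->
  (exists c4 c3 c2 c1 c0 : R, 0 < c4 /\ forall y, covariance_det y =
     y * (y * (y * (y * c4 + c3) + c2) + c1) + c0) \/
  (exists c2 c1 c0 : R, 0 < c2 /\ forall y, covariance_det y = y * (y * c2 + c1) + c0).
Proof.
move=> f0 nprop; have /andP[e0 e1] := e01.
have [gi _] := gs; have [fi _] := fs; have [g'i _] := g's; have [f'i _] := f's.
have h0 : (2^-1 : R) != 0 by rewrite invr_eq0 pnatr_eq0.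
have nh0 : (- 2^-1 : R) != 0 by rewrite oppr_eq0.
have sG : square_integrable (G g) by exact: in_sobolev_square_integrable.
have sG' : square_integrable (G g') by exact: in_sobolev_square_integrable.
have sB : square_integrable (B f) by exact: in_sobolev_square_integrable.
have sB' : square_integrable (B f') by exact: in_sobolev_square_integrable.
have ee : - (3 / 2) < - (3 / 2) + e < 0 by apply/andP; split; lra.
have el : - (3 / 2) + e < - 2^-1 by lra.
have sF : square_integrable (F f) by apply: (square_integrable_low nh0 el).
have sF' : square_integrable (F f') by apply: (square_integrable_low nh0 el).
pose p := inner (F f) (F f); pose p' := inner (F f') (F f'); pose r := inner (F f) (F f').
have p0 : 0 < p.
  rewrite ltNge; apply/negP => /(inner_le0 sF) /(weighted_fourier_ae0 fi) fae.
  move/negP: f0; apply; apply/eqP.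
  rewrite -[RHS]integral3_0; apply: integral3_ae => //.
  by apply/measurable_EFinP; exact: measurable_int fi.
have [P0|P0] := ltP 0 (p * p' - r ^+ 2).
  left.
  do 5 eexists; split; first exact: P0.
  by move=> y; exact: quartic_det.
(* The coefficient of the projection of [F f'] onto [F f]; the residual has squared norm
   [(p p' - r ^ 2) / p], here at most 0. *)
right; pose c := r / p.
have uF : {ae lebesgue3 R, forall k, F f' k - c *: F f k = 0}.
  have su := square_integrableB c sF' sF.
  apply: (inner_le0 su).
  rewrite (innerBl c sF' sF su) (innerBr c sF' sF sF') (innerBr c sF' sF sF) -/p -/p'.
  rewrite (innerC (F f') (F f)) -/r.
  suff -> : p' - c * r - c * (r - c * p) = (p * p' - r ^+ 2) / p.
    by rewrite ler_pdivrMr// mul0r.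
  by rewrite /c; field; rewrite gt_eqF.
have f'E : {ae lebesgue3 R, forall x, f' x - c * f x = 0}.
  apply: (@weighted_fourier_ae0 (- (3 / 2) + e)).
    exact: integrable3B f'i (integrable3Z c fi).
  by move: uF; apply: ae3_mono => k; rewrite weighted_fourierB.
have uB : {ae lebesgue3 R, forall k, B f' k - c *: B f k = 0}.
  move: (ae3_and (@ae3_neq0 R) uF); apply: ae3_mono => k [k0].
  rewrite /F /B -!weighted_fourierB// => /(weighted_fourier_eq0 k0) E.
  by rewrite /weighted_fourier E scaler0.
have FE u : square_integrable u -> inner (F f') u = c * inner (F f) u.
  move=> su; apply/eqP; rewrite -subr_eq0 -innerBl//; apply/eqP.
  by apply: inner_ae0 => //; exact: square_integrableB.
have BE u : square_integrable u -> inner (B f') u = c * inner (B f) u.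
  move=> su; apply/eqP; rewrite -subr_eq0 -innerBl//; apply/eqP.
  by apply: inner_ae0 => //; exact: square_integrableB.
(* The weighted transform of [g' - c g], what remains of the second mode after [c] times the first
   is subtracted. *)
pose D k := G g' k - c *: G g k.
have sD : square_integrable D by exact: square_integrableB.
have a'E : inner D D = inner (G g') (G g') - c * inner (G g) (G g')
    - c * (inner (G g) (G g') - c * inner (G g) (G g)).
  rewrite (innerBl c sG' sG sD) (innerBr c sG' sG sG') (innerBr c sG' sG sG).
  by rewrite (innerC (G g') (G g)).
have q'E : inner (F f) D = inner (F f) (G g') - c * inner (F f) (G g).
  exact: (innerBr c sG' sG sF).
have det0 : 0 < inner D D * p - inner (F f) D ^+ 2.
  (* Projecting again, a non-positive determinant would give [D = t F f]; the behaviour at [k = 0]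
     forces [t = 0], hence [g' = c g] and proportional modes. *)
  rewrite ltNge; apply/negP => dle; pose t := inner (F f) D / p.
  have uD : {ae lebesgue3 R, forall k, D k - t *: F f k = 0}.
    apply: (inner_le0 (square_integrableB t sD sF)).
    rewrite (innerBl t sD sF (square_integrableB t sD sF)).
    rewrite (innerBr t sD sF sD) (innerBr t sD sF sF) (innerC D (F f)) -/p.
    suff -> : inner D D - t * inner (F f) D - t * (inner (F f) D - t * p) =
        (inner D D * p - inner (F f) D ^+ 2) / p by rewrite ler_pdivrMr// mul0r.
    by rewrite /t; field; rewrite gt_eqF.
  have di : integrable3 (fun x => g' x - c * g x).
    exact: integrable3B g'i (integrable3Z c gi).
  have t0 : t = 0.
    apply: (weighted_fourier_prop_eq0 e01 di fi f0).
    move: uD; apply: ae3_mono => k /eqP; rewrite subr_eq0 => /eqP <-.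
    by rewrite weighted_fourierB.
  have g'E : {ae lebesgue3 R, forall x, g' x - c * g x = 0}.
    apply: (@weighted_fourier_ae0 2^-1) => //.
    move: uD; apply: ae3_mono => k; rewrite t0 scale0r subr0.
    by rewrite weighted_fourierB.
  apply: nprop; exists c; move: (ae3_and f'E g'E); apply: ae3_mono => x [].
  by move=> /eqP; rewrite subr_eq0 => /eqP -> /eqP; rewrite subr_eq0 => /eqP ->.
do 3 eexists; split; first exact: det0.
move=> y; rewrite a'E q'E /covariance_det /covariance /=.
(* Symmetry moves the transforms of [f'] to the left, where [FE] and [BE] replace them by [c] times
   those of [f]; a second pass treats what the diagonal terms leave. *)
rewrite (innerC (F f) (F f')) (innerC (B f) (B f')).
rewrite (FE _ sF) (FE _ sG) (FE _ sG') (BE _ sB) (FE _ sF') (BE _ sB').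
rewrite (innerC (F f) (F f')) (innerC (B f) (B f')) (FE _ sF) (BE _ sB).
exact: quadratic_det.
Qed.

End TwoModes.
End GramDeterminant.

(** * Non-vanishing of [kappa] *)

Section GammaConstant.
Context {R : realType}.
Local Notation mu := (@lebesgue_measure R).

Let integrand (a t : R) : R := t `^ a * expR (- t).

Let measurable_integrand a : measurable_fun setT (integrand a).
Proof.
apply: measurable_funM; first exact: measurable_powR.
apply: measurableT_comp; first exact: measurable_expR.
exact: measurable_funN.
Qed.

(** From [t ^ a <= 1 + t <= 2 e ^ (t / 2)] the integrand is at most [2 e ^ (- t / 2)], which is 4
    times the exponential density of rate [1 / 2]. *)
Let integrable_integrand a : 0 <= a <= 1 ->
  mu.-integrable `]0, +oo[ (EFin \o integrand a).
Proof.
move=> /andP[a0 a1].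
have ie : mu.-integrable `]0, +oo[ (fun t => (4 * exponential_pdf 2^-1 t)%:E).
  have : mu.-integrable `]0, +oo[ (EFin \o exponential_pdf 2^-1).
    apply: (integrableS _ _ (@subsetT _ _)); [exact: measurableT|exact: measurable_itv|].
    by apply: integrable_exponential_pdf; rewrite ?invr_ge0 ?invr_gt0.
  by apply: integrableZl; exact: measurable_itv.
apply: le_integrable ie => //.
  by apply/measurable_EFinP; apply: measurable_funTS; exact: measurable_integrand.
move=> t /=; rewrite in_itv/= andbT => t0.
rewrite lee_fin ger0_norm ?mulr_ge0 ?powR_ge0 ?expR_ge0//.
rewrite (le_trans _ (ler_norm _))// exponential_pdfE ?(ltW t0)//.
rewrite /integrand; have -> : expR (- t) = expR (- (2^-1 * t)) * expR (- (2^-1 * t)).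
  by rewrite -expRD; congr expR; field.
rewrite /integrand mulNr !mulrA ler_wpM2r ?expR_ge0//.
rewrite expRN ler_pdivrMr ?expR_gt0//.
have := expR_ge1Dx (2^-1 * t).
have : t `^ a <= 1 + t.
  have [t1|t1] := leP 1 t.
    by apply: le_trans (ler1_powR t1 a1) _; rewrite lerDr.
  have : t `^ a <= 1 `^ a by apply: ge0_ler_powR; rewrite ?nnegrE// ltW.
  by rewrite powR1; lra.
lra.
Qed.

(** On []1, 2[], of length 1, the integrand is at least [e ^ (- 2)]. *)
Lemma Gamma_pos_gt0 (x : R) : 1 <= x <= 2 -> 0 < Gamma_pos x.
Proof.
move=> /andP[x1 x2]; pose a := x - 1.
have ai : 0 <= a <= 1 by rewrite /a; apply/andP; split; lra.
have ii := integrable_integrand ai.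
have f0 t : 0 <= integrand a t by rewrite mulr_ge0 ?powR_ge0 ?expR_ge0.
apply: (@lt_le_trans _ _ (expR (- 2))); first exact: expR_gt0.
rewrite -lee_fin /Gamma_pos /Rintegral fineK; last exact: integrable_fin_num.
apply: (@le_trans _ _ (\int[mu]_(t in `]1%R, 2%R[) (integrand a t)%:E)%E); last first.
  apply: ge0_subset_integral => //.
  - by apply/measurable_EFinP; apply: measurable_funTS; exact: measurable_integrand.
  - by move=> t _; rewrite lee_fin.
  - by move=> t /=; rewrite !in_itv/= andbT => /andP[t1 _]; apply: lt_trans t1.
apply: (@le_trans _ _ (\int[mu]_(t in `]1%R, 2%R[) (expR (- 2))%:E)%E).
  rewrite integral_cst//= lebesgue_measure_itv/= lte_fin ltr1n -EFinB -EFinM lee_fin.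
  by rewrite (_ : 2 - 1 = 1 :> R) ?mulr1//; ring.
apply: ge0_le_integral => //.
- by apply/measurable_EFinP; apply: measurable_funTS; exact: measurable_integrand.
move=> t /=; rewrite in_itv/= => /andP[t1 t2]; rewrite lee_fin /integrand.
rewrite -[leLHS]mul1r ler_pM ?expR_ge0// ?ler_expR ?lerN2 ?(ltW t2)//.
rewrite -(powRr0 t); apply: ler_powR; first exact: ltW.
by case/andP: ai.
Qed.

(** Here [cos (pi e) > 0], and [- 1 / 2 + e] has floor [-1], so the continuation takes two steps:
    [Gamma_pos (3 / 2 + e)] over [(- 1 / 2 + e) (1 / 2 + e)], where no factor vanishes. *)
Lemma kappa_neq0 (e : R) : 0 < e < 2^-1 -> kappa e != 0.
Proof.
move=> /andP[e0 e2]; rewrite /kappa mulf_neq0//.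
  by rewrite mulf_neq0// gt_eqF// ?powR_gt0// sqrtr_gt0 pi_gt0.
rewrite invr_neq0// mulf_neq0//.
  rewrite gt_eqF// cos_gt0_pihalf//; have := pi_gt0 R => p0.
  by apply/andP; split; nra.
rewrite /Gamma ifF; last by apply/negbTE; rewrite -leNgt; lra.
have -> : Num.floor (- 2^-1 + e) = (-1)%Z.
  by apply: floor_def; apply/andP; split; rewrite ?addNr ?rmorphN1 ?rmorph0 ?mulrN1z ?mulr0z; lra.
rewrite /= mulf_neq0//.
  by rewrite gt_eqF// Gamma_pos_gt0//; apply/andP; split; lra.
rewrite invr_neq0// !big_ord_recl big_ord0 /= mulr1 mulf_neq0//.
  by rewrite addr0 lt_eqF//; lra.
by rewrite /bump /= gt_eqF//; lra.
Qed.

End GammaConstant.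

(** * Monotonicity of the entropy and growth of polynomials *)

Section Entropy.
Context {R : realType}.

Lemma ln_tangent (x c : R) : 0 < x -> 0 < c -> ln x <= ln c + (x / c - 1).
Proof.
move=> x0 c0; have xc : 0 < x / c by rewrite divr_gt0.
rewrite -{1}(divfK (lt0r_neq0 c0) x) lnM ?posrE// addrC lerD2l.
by rewrite -{1}(subrKC 1 (x / c)) le_ln1Dx//; lra.
Qed.

(** Jensen's inequality: [1 + 1 / b] is the mean of [1 + 1 / a] and 1 with weights [a / b] and
    [(b - a) / b]. In the sum of the two tangent bounds at this mean the linear terms cancel. *)
Lemma mul_ln1V_le (a b : R) : 0 < a -> a < b ->
  a * ln (1 + a^-1) <= b * ln (1 + b^-1).
Proof.
move=> a0 ab; have b0 : 0 < b by exact: lt_trans ab.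
have c0 : 0 < 1 + b^-1 by rewrite addr_gt0// invr_gt0.
have x0 : 0 < 1 + a^-1 by rewrite addr_gt0// invr_gt0.
have h1 := ler_wpM2l (ltW a0) (ln_tangent x0 c0).
have ba : 0 <= b - a by rewrite subr_ge0 ltW.
have h2 := ler_wpM2l ba (ln_tangent ltr01 c0).
move: h1 h2; rewrite ln1 mulr0.
set L := ln (1 + b^-1).
have -> : a * (L + ((1 + a^-1) / (1 + b^-1) - 1)) = a * L + (b - a) / (b + 1).
  by field; rewrite !gt_eqF//= addr_gt0.
have -> : (b - a) * (L + (1 / (1 + b^-1) - 1)) = (b - a) * L - (b - a) / (b + 1).
  by field; rewrite !gt_eqF//= addr_gt0.
lra.
Qed.

(** With [x = (n - 1) / 2] the entropy is [x ln (1 + 1 / x) + ln (1 + x)] over [ln 2]: a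
    non-decreasing term plus a strictly increasing one. *)
Lemma entropy_increasing (n1 n2 : R) : 1 < n1 -> n1 < n2 -> entropy n1 < entropy n2.
Proof.
move=> n11 n12.
have eE n : 1 < n -> entropy n =
    ((n - 1) / 2 * ln (1 + ((n - 1) / 2)^-1) + ln ((n - 1) / 2 + 1)) / ln 2.
  move=> ngt1; rewrite /entropy /log2.
  have x0 : 0 < (n - 1) / 2 by lra.
  have -> : (n + 1) / 2 = (n - 1) / 2 + 1 by field.
  set x := (n - 1) / 2 in x0 *; clearbody x.
  have -> : 1 + x^-1 = (x + 1) / x by field; rewrite gt_eqF.
  rewrite ln_div ?posrE ?addr_gt0//.
  by field; rewrite gt_eqF// ln_gt0// ltr1n.
rewrite !eE//; last exact: lt_trans n12.
rewrite ltr_pM2r ?invr_gt0 ?ln_gt0 ?ltr1n//.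
have a0 : 0 < (n1 - 1) / 2 by lra.
have ab : (n1 - 1) / 2 < (n2 - 1) / 2 by lra.
apply: ler_ltD; first exact: mul_ln1V_le.
by rewrite ltr_ln ?posrE; lra.
Qed.

(** Divergence and eventual strict increase together survive multiplication by [y] and addition of
    any constant, which handles polynomials in Horner form. *)
Definition grows (F : R -> R) := forall K : R, exists2 Y : R, 0 < Y &
  forall y1 y2, Y <= y1 -> y1 < y2 -> K <= F y1 /\ F y1 < F y2.

Lemma grows_linear (c d : R) : 0 < c -> grows (fun y => y * c + d).
Proof.
move=> c0 K; exists (Num.max 1 ((K - d) / c)); first by rewrite lt_max ltr01.
move=> y1 y2; rewrite ge_max => /andP[_ Ky] y12; split; last by rewrite ltrD2r ltr_pM2r.
by rewrite -lerBlDr -ler_pdivrMr.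
Qed.

Lemma grows_mul (F : R -> R) (d : R) : grows F -> grows (fun y => y * F y + d).
Proof.
(* The maxima with 1 make both factors at least 1, so that [y * F y >= F y >= K - d] and the product
   increases. *)
move=> gF K; have [Y Y0 FY] := gF (Num.max 1 (K - d)).
exists (Num.max 1 Y); first by rewrite lt_max ltr01.
move=> y1 y2; rewrite ge_max => /andP[y1_1 /FY FY1] y12.
have [+ F12] := FY1 y2 y12; rewrite ge_max => /andP[F1 FK].
split; last by rewrite ltrD2r; nra.
by rewrite -lerBlDr; nra.
Qed.

End Entropy.

(** * From the covariance metric to a growing determinant *)

Section Growth.
Context {R : realType}.

(** Each Sobolev order is half the sum of two weight exponents; for the cross terms these are
    [- 3 / 2 + e] and [1 / 2]. *)
Lemma bd_sigmaE (m H e : R) (a b : phase R) : 0 < H -> 0 < e < 2^-1 -> musq m H = e ->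
  bd_sigma m H a b = covariance e (kappa e * H `^ (1 - e)) a b.
Proof.
move=> H0 /andP[e0 e2] mE; rewrite /bd_sigma mE; case: a b => [g f] [g' f'].
have h0 : (2^-1 : R) != 0 by rewrite invr_eq0 pnatr_eq0.
have s1 : - (3 / 2) + e + 2^-1 = 2 * - ((1 - e) / 2) by field.
have s0 : - ((1 - e) / 2) != 0 by rewrite lt_eqF//; lra.
rewrite /covariance; congr (_ + _ + _ - _).
- by apply: Re_sobolev => //; field.
- by apply: Re_sobolev; [field|rewrite oppr_eq0].
- have -> : (kappa e * H `^ (1 - e)) ^+ 2 = kappa e ^+ 2 * H `^ (2 - 2 * e).
    rewrite (_ : 2 - 2 * e = (1 - e) * 2%:R); last by ring.
    by rewrite powRrM powR_mulrn ?powR_ge0//; set k := kappa e; rewrite exprMn.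
  congr (_ * _); apply: Re_sobolev; first by field.
  by rewrite lt_eqF//; lra.
- by congr (_ * (_ + _)); exact: Re_sobolev.
Qed.

Lemma det_mx22 (A : 'M[R]_2) : \det A = A 0 0 * A 1 1 - A 0 1 * A 1 0.
Proof.
rewrite (expand_det_row _ 0) !big_ord_recl big_ord0 addr0 /cofactor !det_mx11 !mxE.
rewrite expr0 expr1 mul1r mulN1r mulrN.
by congr (A 0 _ * A _ _ - A 0 _ * A _ _); apply/val_inj.
Qed.

Lemma ord2_neq (i j : 'I_2) : i != j -> (i = 0 /\ j = 1) \/ (i = 1 /\ j = 0).
Proof.
case: i j => [[|[|]]//= ?] [[|[|]]//= ?] _; [left|right]; split; exact/val_inj.
Qed.

Lemma covarianceC (e y : R) (a b : phase R) : covariance e y a b = covariance e y b a.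
Proof.
have sym (u u' v v' w w' p q : R) : u = u' -> v = v' -> w = w' ->
    u + v + y ^+ 2 * w - y * (p + q) = u' + v' + y ^+ 2 * w' - y * (q + p).
  by move=> -> -> ->; rewrite (addrC p).
by apply: sym; exact: innerC.
Qed.

(** Either order of the modes is allowed, so that one with a non-zero field part can come first. *)
Lemma det_covariance_matrix (m H e : R) (gam : 'I_2 -> phase R) (i j : 'I_2) :
  i != j -> 0 < H -> 0 < e < 2^-1 -> musq m H = e ->
  \det (covariance_matrix m H gam) =
  covariance_det e (gpart (gam i)) (fpart (gam i)) (gpart (gam j)) (fpart (gam j))
    (kappa e * H `^ (1 - e)).
Proof.
move=> ij H0 e02 mE; rewrite det_mx22 !mxE !(bd_sigmaE _ _ H0 e02 mE) /covariance_det.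
have E k : Phase (gpart (gam k)) (fpart (gam k)) = gam k by case: (gam k).
rewrite !E expr2; set y := kappa e * _; clearbody y.
have [[-> ->]|[-> ->]] := ord2_neq ij.
  by rewrite (covarianceC e y (gam 1) (gam 0)).
rewrite (covarianceC e y (gam 1) (gam 0)).
exact: (congr1 (fun z => z - _) (mulrC _ _)).
Qed.

Lemma powR_grows (e : R) (F : R -> R) : e < 1 -> grows F -> grows (fun H => F (H `^ (1 - e))).
Proof.
move=> e1 gF K; have [Y Y0 FY] := gF K; have d0 : 0 < 1 - e by rewrite subr_gt0.
exists (Y `^ (1 - e)^-1); first exact: powR_gt0.
move=> H1 H2 YH1 H12.
have H10 : 0 < H1 by apply: lt_le_trans YH1; exact: powR_gt0.
have H20 := lt_trans H10 H12.
apply: FY; last by apply: gt0_ltr_powR; rewrite ?nnegrE ?ltW.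
have : (Y `^ (1 - e)^-1) `^ (1 - e) <= H1 `^ (1 - e).
  apply: ge0_ler_powR; rewrite ?nnegrE//; [exact: ltW|exact: powR_ge0|exact: ltW].
by rewrite -powRrM mulVf ?gt_eqF// powRr1// ltW.
Qed.

(** The sign of [kap] is immaterial: the leading coefficients carry its fourth or second power. *)
Lemma covariance_det_grows (e kap : R) (g f g' f' : space R -> R) : 0 < e < 1 -> kap != 0 ->
  in_sobolev 2^-1 g -> in_sobolev (- 2^-1) f ->
  in_sobolev 2^-1 g' -> in_sobolev (- 2^-1) f' -> integral3 f != 0 ->
  ~ (exists c : R, {ae lebesgue3 R, forall x, f' x = c * f x /\ g' x = c * g x}) ->
  grows (fun z => covariance_det e g f g' f' (kap * z)).
Proof.
move=> e01 k0 gs fs g's f's f0 nprop.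
have k2 : 0 < kap ^+ 2 by rewrite exprn_even_gt0.
have [[c4 [c3 [c2 [c1 [c0 [c40 E]]]]]]|[c2 [c1 [c0 [c20 E]]]]] :=
  covariance_det_growth e01 gs fs g's f's f0 nprop.
- have : grows (fun z => z * (z * (z * (z * (kap ^+ 4 * c4) + kap ^+ 3 * c3)
      + kap ^+ 2 * c2) + kap * c1) + c0).
    do 3! apply: grows_mul; apply: grows_linear.
    by rewrite mulr_gt0// exprn_even_gt0.
  congr grows; apply/funext => z; rewrite E; ring.
- have : grows (fun z => z * (z * (kap ^+ 2 * c2) + kap * c1) + c0).
    by apply: grows_mul; apply: grows_linear; rewrite mulr_gt0.
  congr grows; apply/funext => z; rewrite E; ring.
Qed.

End Growth.

(** * Strict increase of the entropy with the Hubble rate *)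

Theorem proposition2 (R : realType) :
  exists mu2max : R, 0 < mu2max /\
  forall (gam : 'I_2 -> phase R),
    single_mode gam ->
    non_special gam ->
  forall (mu2 : R), 0 < mu2 < mu2max ->
  forall m : R -> R, (forall H : R, 0 < H -> 0 < m H /\ musq (m H) H = mu2) ->
  exists H0 : R, 0 < H0 /\
    {in `[H0, +oo[ &,
      {homo (fun H : R => entropy (nu (m H) H gam)) : H1 H2 / H1 < H2}}.
Proof.
(* The range in which [kappa_neq0] holds. *)
exists 2^-1; split; first by rewrite invr_gt0.
move=> gam [sob _ sym] ns e e02 m mE.
have /andP[e0 e2] := e02.
have mf i : measurable_fun setT (fpart (gam i)).
  by have [_ [+ _]] := sob i => /measurable_int/measurable_EFinP.
have mg i : measurable_fun setT (gpart (gam i)).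
  by have [[+ _] _] := sob i => /measurable_int/measurable_EFinP.
have sym0 : ~ {ae lebesgue3 R, forall x, fpart (gam 1) x * gpart (gam 0) x
    - gpart (gam 1) x * fpart (gam 0) x = 0}.
  move=> s0; move: sym; rewrite /symplectic (integral3_ae (G := fun=> 0))//.
    by rewrite integral3_0 => /eqP; rewrite eq_sym oner_eq0.
  by apply: measurable_funB; apply: measurable_funM.
(* Two null field parts would make the symplectic product 0; [non_special] gives the one that
   survives a non-zero integral. *)
have [i fi] : exists i, ~ {ae lebesgue3 R, forall x, fpart (gam i) x = 0}.
  apply: contrapT => nex; apply: sym0.
  have ae0 i : {ae lebesgue3 R, forall x, fpart (gam i) x = 0}.
    by apply: contrapT => ?; apply: nex; exists i.
  move: (ae3_and (ae0 0) (ae0 1)); apply: ae3_mono => x [-> ->].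
  by rewrite mul0r mulr0 subr0.
have f0 : integral3 (fpart (gam i)) != 0 by apply/eqP; exact: ns fi.
have [j ij] : exists j : 'I_2, i != j.
  by exists (if i == 0 then 1 else 0); case: (eqVneq i 0) => [->|].
have nprop : ~ (exists c : R, {ae lebesgue3 R, forall x,
    fpart (gam j) x = c * fpart (gam i) x /\ gpart (gam j) x = c * gpart (gam i) x}).
  move=> [c fg]; apply: sym0; move: fg; apply: ae3_mono => x.
  have [[-> ->]|[-> ->]] := ord2_neq ij.
  - by move=> [-> ->]; ring.
  - by move=> [-> ->]; ring.
have [[gs fs] [g's f's]] := (sob i, sob j).
have e1 : 0 < e < 1 by apply/andP; split; lra.
have gr : grows (fun H => covariance_det e (gpart (gam i)) (fpart (gam i))
    (gpart (gam j)) (fpart (gam j)) (kappa e * H `^ (1 - e))).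
  apply: (@powR_grows _ e (fun z => covariance_det e _ _ _ _ (kappa e * z))); first lra.
  exact: (covariance_det_grows e1 (kappa_neq0 e02)).
(* The bound 2 keeps the determinant above 1, hence [nu] above 1, as [entropy_increasing]
   requires. *)
have [H0 H00 HH] := gr 2.
exists H0; split=> // H1 H2; rewrite !in_itv/= !andbT => H01 H02 H12.
have [D1 D12] := HH _ _ H01 H12.
have H1p := lt_le_trans H00 H01; have H2p := lt_le_trans H00 H02.
have nuE H : 0 < H -> nu (m H) H gam = Num.sqrt (covariance_det e (gpart (gam i))
    (fpart (gam i)) (gpart (gam j)) (fpart (gam j)) (kappa e * H `^ (1 - e))).
  by move=> Hp; congr Num.sqrt; apply: det_covariance_matrix => //; exact: (mE _ Hp).2.
have -> : nu (m H1) H1 gam = _ := nuE _ H1p.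
have -> : nu (m H2) H2 gam = _ := nuE _ H2p.
move: D1 D12; set D := covariance_det _ _ _ _ _ _; set D' := covariance_det _ _ _ _ _ _.
clearbody D D' => D1 D12.
apply: entropy_increasing; last by rewrite ltr_sqrt//; lra.
by rewrite -[ltLHS]sqrtr1 ltr_sqrt; lra.
Qed.
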